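(* Let $d\in\mathbb{N}$, let $\mathcal{T}_d$ be the full Fock space over $\mathbb{C}^d$, let $L_1,\dots,L_d$ and $R_1,\dots,R_d$ be the left and respectively right creation operators on $\mathcal{T}_d$ associated to the standard orthonormal basis $e_1,\dots,e_d$ of $\mathbb{C}^d$, and put $$T_d:=\sum_{i=1}^d(L_i+L_i^* )(R_i+R_i^* )\in B(\mathcal{T}_d).$$ Then $T_d=T_d^*$, and $$\varphi_{\mathrm{vac}}(T_d^n)=Q_n(d),\qquad\forall\,n\in\mathbb{N},$$ where $Q_n$ is the $n$th semi-meander polynomial.
   Context: $\mathbb{N}=\{1,2,3,\dots\}$. Full Fock space: $\mathcal{T}_d=\mathbb{C}\oplus\bigoplus_{n\ge1}(\mathbb{C}^d)^{\otimes n}$ (Hilbert space orthogonal direct sum, with the usual tensor product inner products); the vector $1\in\mathbb{C}$ is the vacuum vector $\xi_{\mathrm{vac}}$, and $\varphi_{\mathrm{vac}}(X)=\langle X\xi_{\mathrm{vac}},\xi_{\mathrm{vac}}\rangle$ for $X\in B(\mathcal{T}_d)$. The operators are determined by $L_i\xi_{\mathrm{vac}}=e_i=R_i\xi_{\mathrm{vac}}$, $L_i(v_1\otimes\cdots\otimes v_n)=e_i\otimes v_1\otimes\cdots\otimes v_n$, $R_i(v_1\otimes\cdots\otimes v_n)=v_1\otimes\cdots\otimes v_n\otimes e_i$. Semi-meander polynomials: $\mathrm{NC}_2(2n)$ is the set of non-crossing pair-partitions of $\{1,\dots,2n\}$, i.e. partitions into $n$ blocks of size 2 for which there are no $a<b<c<d$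 with $\{a,c\}$ and $\{b,d\}$ both blocks. $\rho_{2n}=\{\{1,2n\},\{2,2n-1\},\dots,\{n,n+1\}\}$ is the rainbow pair-partition. A meandric system of order $n$ is a picture obtained by drawing $\pi\in\mathrm{NC}_2(2n)$ as arches above a horizontal line and $\sigma\in\mathrm{NC}_2(2n)$ as arches below it; its number of components (closed curves) is $|\pi\vee\sigma|$, the number of blocks of the join of $\pi$ and $\sigma$ in the lattice of all partitions of $\{1,\dots,2n\}$ under reverse refinement order. Let $r_n^{(k)}$ be the number of meandric systems of order $n$ with $\sigma=\rho_{2n}$ and with exactly $k$ components. Then $Q_n(t)=\sum_{k=1}^n r_n^{(k)}t^k$; equivalently $Q_n(t)=\sum_{\pi\in\mathrm{NC}_2(2n)}t^{|\pi\vee\rho_{2n}|}$. *)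

(* Defs.v *)
From HB Require Import structures.
From mathcomp Require Import all_boot all_order all_algebra.
From mathcomp Require Import ring lra zify.

Set Implicit Arguments.
Unset Strict Implicit.
Unset Printing Implicit Defensive.

Import Order.TTheory GRing.Theory Num.Theory.

Local Open Scope ring_scope.

Section PartitionLattice.
Variable T : finType.
Implicit Types P Q J K : {set {set T}}.

Definition refines P Q := [forall A in P, exists B in Q, A \subset B].

Definition is_join P Q J :=
  [&& partition J [set: T], refines P J, refines Q J &
    [forall K, [&& partition K [set: T], refines P K & refines Q K] ==>
       refines J K]].

Lemma join_exists P Q : partition P [set: T] -> partition Q [set: T] ->
  exists J, is_join P Q J.
Proof.
move=> pP pQ.
pose e := [rel x y | [exists A in P :|: Q, (x \in A) && (y \in A)]].
have esym : connect_sym e.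
  apply: sym_connect_sym => x y /=.
  by apply: eq_existsb => A; rewrite [(y \in A) && _]andbC.
pose J := equivalence_partition (connect e) [set: T].
have eqv : {in [set: T] & &, equivalence_rel (connect e)}.
  by move=> x y z _ _ _; split=> [|xy]; [exact: connect0 | exact: same_connect].
have pJ : partition J [set: T] := equivalence_partitionP eqv.
have JE x y : (y \in pblock J x) = connect e x y.
  by rewrite (pblock_equivalence_partition eqv) ?inE.
have cov K x : partition K [set: T] -> x \in cover K.
  by case/and3P=> /eqP ->; rewrite inE.
have refJ K : partition K [set: T] -> K \subset P :|: Q -> refines K J.
  move=> pK sK; apply/forall_inP => A AK.
  have [x xA] : exists x, x \in A.
    apply/set0Pn; apply: contraTneq AK => ->; by case/and3P: pK.
  apply/exists_inP; exists (pblock J x); first by rewrite pblock_mem // cov.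
  apply/subsetP => y yA; rewrite JE; apply: connect1; apply/exists_inP.
  by exists A; rewrite ?(subsetP sK) // xA.
exists J; apply/and4P; split=> //; rewrite ?refJ ?subsetUl ?subsetUr //.
apply/forallP => K; apply/implyP => /and3P[pK rP rQ].
have [_ tK _] := and3P pK.
have sub x y : connect e x y -> y \in pblock K x.
  case/connectP => p; elim: p x => [|z p IH] x /=; first by move=> _ ->; rewrite mem_pblock cov.
  case/andP=> /exists_inP[A AU /andP[xA zA]] /IH h /h.
  have [B BK AB] : exists2 B, B \in K & A \subset B.
    apply/exists_inP.
    by case/setUP: AU => AU; [apply: (forall_inP rP) | apply: (forall_inP rQ)].
  have zx : z \in pblock K x.
    by rewrite (def_pblock tK BK) ?(subsetP AB).
  by rewrite -(same_pblock tK zx).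
apply/forall_inP => A /imsetP[x _ ->]; apply/exists_inP; exists (pblock K x).
  by rewrite pblock_mem // cov.
by apply/subsetP => y; rewrite inE => /andP[_]; exact: sub.
Qed.

(* the join in the lattice of partitions of T; the default value P is never
   reached when P and Q are partitions, see pjoinP *)
Definition pjoin P Q : {set {set T}} := odflt P [pick J | is_join P Q J].

Lemma pjoinP P Q : partition P [set: T] -> partition Q [set: T] ->
  is_join P Q (pjoin P Q).
Proof.
move=> pP pQ; rewrite /pjoin; case: pickP => //= h.
by have [J] := join_exists pP pQ; rewrite h.
Qed.

End PartitionLattice.

(* {1, ..., 2n} is represented by 'I_(2 * n) = {0, ..., 2n - 1} *)
Section Meanders.
Variable n : nat.
Local Notation I := 'I_(2 * n).

Definition pair_partition (P : {set {set I}}) :=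
  partition P [set: I] && [forall B in P, #|B| == 2].

Definition noncrossing (P : {set {set I}}) :=
  [forall a : I, forall b : I, forall c : I, forall d : I,
    [&& a < b, b < c & c < d]%N ==>
    ~~ (([set a; c] \in P) && ([set b; d] \in P))].

Definition NC2 : {set {set {set I}}} :=
  [set P | pair_partition P && noncrossing P].

Definition rainbow : {set {set I}} := [set [set i; rev_ord i] | i : I & (i < n)%N].

Lemma rainbow_pair (i j : I) :
  ([set i; j] \in rainbow) = (i + j == (2 * n).-1)%N.
Proof.
apply/imsetP/eqP => [[k]|ij].
  rewrite inE => kn E.
  have : k \in [set i; j] by rewrite E set21.
  have : rev_ord k \in [set i; j] by rewrite E set22.
  have : i \in [set k; rev_ord k] by rewrite -E set21.
  have : j \in [set k; rev_ord k] by rewrite -E set22.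
  by rewrite !inE -!val_eqE /=; lia.
have i2n := ltn_ord i; have [i_n|ni] := ltnP i n.
  exists i; rewrite ?inE //.
  by congr (_ |: [set _]); apply: val_inj => /=; lia.
exists j; rewrite ?inE; first by lia.
by rewrite setUC; congr (_ |: [set _]); apply: val_inj => /=; lia.
Qed.

Lemma rainbow_NC2 : rainbow \in NC2.
Proof.
have memf (i x : I) : (x \in [set i; rev_ord i]) =
    ((x == i :> nat) || (x + i == (2 * n).-1)%N).
  rewrite !inE -val_eqE; congr (_ || _); rewrite -val_eqE /=.
  by have := ltn_ord x; have := ltn_ord i; lia.
have disj (i j x : I) : (i < n)%N -> (j < n)%N ->
    x \in [set i; rev_ord i] -> x \in [set j; rev_ord j] -> i = j.
  by rewrite !memf => ? ? ? ?; apply: val_inj => /=; lia.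
rewrite inE; apply/andP; split; last first.
  apply/forallP => a; apply/forallP => b; apply/forallP => c.
  apply/forallP => d; apply/implyP => abcd; rewrite !rainbow_pair.
  by lia.
apply/andP; split; last first.
  apply/forall_inP => B /imsetP[i]; rewrite inE => i_n ->.
  by rewrite cards2 -val_eqE /=; lia.
apply/and3P; split.
- apply/eqP/setP => x; rewrite inE; apply/bigcupP.
  have [xn|nx] := ltnP x n.
    by exists [set x; rev_ord x]; rewrite ?memf ?eqxx //; apply: imset_f; rewrite inE.
  exists [set rev_ord x; rev_ord (rev_ord x)]; last by rewrite rev_ordK !inE eqxx orbT.
  by apply: imset_f; rewrite inE /=; have := ltn_ord x; lia.
- apply/trivIsetP => _ _ /imsetP[i i_n ->] /imsetP[j j_n ->]; apply: contraNT.
  rewrite !inE in i_n j_n.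
  by case/pred0Pn => x /andP[/= xi xj]; rewrite (disj _ _ _ i_n j_n xi xj).
- by apply/imsetP => -[i _ /setP/(_ i)]; rewrite !inE eqxx.
Qed.

Definition meandric_systems : {set {set {set I}} * {set {set I}}} := setX NC2 NC2.

Definition components (M : {set {set I}} * {set {set I}}) : nat :=
  #|pjoin M.1 M.2|.

Definition semi_meander_number (k : nat) : nat :=
  #|[set M in meandric_systems | (M.2 == rainbow) && (components M == k)]|.

Definition semi_meander_poly : {poly int} :=
  \sum_(1 <= k < n.+1) (semi_meander_number k)%:R *: 'X^k.

End Meanders.

From mathcomp Require Import complex.
From mathcomp Require Import all_classical all_reals all_analysis.

Import numFieldNormedType.Exports.

Local Open Scope complex_scope.
Local Open Scope classical_set_scope.

Local Notation Re := complex.Re.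
Local Notation Im := complex.Im.

Section ComplexConvergence.
Variable R : realType.
Implicit Types (u : nat -> R[i]) (z l : R[i]).

Lemma RRe_gt0 (e : R[i]) : 0 < e -> exists2 r : R, 0 < r & e = r%:C.
Proof.
case: e => a b; rewrite ltcE /= => /andP[/eqP -> a0]; by exists a.
Qed.

Lemma cvg_Re u l : (u : nat -> R[i]^o) @ \oo --> (l : R[i]^o) ->
  (fun n => Re (u n)) @ \oo --> Re l.
Proof.
move=> /cvgrPdist_lt ul; apply/cvgrPdist_lt => e e0.
have e0' : 0 < e%:C by rewrite (ltcR 0).
apply: filterS (ul _ e0') => n /=; rewrite -ltcR; apply: le_lt_trans.
have -> : Re l - Re (u n) = Re (l - u n) by case: l {ul} => ? ?; case: (u n).
exact: normc_ge_Re.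
Qed.

Lemma cvg_complex u l :
  (fun n => Re (u n)) @ \oo --> Re l -> (fun n => Im (u n)) @ \oo --> Im l ->
  (u : nat -> R[i]^o) @ \oo --> (l : R[i]^o).
Proof.
move=> /cvgrPdist_lt ra /cvgrPdist_lt rb; apply/cvgrPdist_lt => e /RRe_gt0[r r0 ->].
have r2 : 0 < r / 2 by rewrite divr_gt0.
have subE (p q : R[i]) : p - q = (Re p - Re q)%:C + 'i%C * (Im p - Im q)%:C.
  by case: p => a b; case: q => a' b'; simpc.
near=> n.
have la : `|Re l - Re (u n)| < r / 2 by near: n; exact: ra.
have lb : `|Im l - Im (u n)| < r / 2 by near: n; exact: rb.
rewrite subE.
apply: le_lt_trans (ler_normD _ _) _.
rewrite normrM.
have -> : `|'i%C : R[i]| = 1 by rewrite normc_def /= expr0n expr1n add0r sqrtr1.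
rewrite mul1r !normc_def /= expr0n !addr0 !sqrtr_sqr -rmorphD ltcR.
by rewrite [ltRHS](splitr r) ltrD.
Unshelve. all: by end_near. Qed.

Lemma cvg_conjc u l : (u : nat -> R[i]^o) @ \oo --> (l : R[i]^o) ->
  ((fun n => (u n)^*%R) : nat -> R[i]^o) @ \oo --> (l^*%R : R[i]^o).
Proof.
move=> /cvgrPdist_lt ul; apply/cvgrPdist_lt => e e0.
by apply: filterS (ul _ e0) => n /=; rewrite -rmorphB /= norm_conjC.
Qed.

End ComplexConvergence.

(* (C^d)^{(x)n}, as coordinate functions in the basis
   e_{w_1} (x) ... (x) e_{w_n}, w in {0, ..., d-1}^n *)
Definition tensor_power (R : realType) (d n : nat) :=
  {ffun n.-tuple 'I_d -> R[i]}.
HB.instance Definition _ (R : realType) (d n : nat) :=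
  GRing.Lmodule.on (tensor_power R d n).

Section TensorPower.
Variables (R : realType) (d : nat).
Local Notation C := R[i].
Local Notation V n := (tensor_power R d n).

Definition tdot n (x y : V n) : C := \sum_(w : n.-tuple 'I_d) x w * (y w)^*%R.

(* the elementary tensor v_1 (x) ... (x) v_n *)
Definition tprod n (v : n.-tuple 'rV[C]_d) : V n :=
  [ffun w : n.-tuple 'I_d => \prod_(k < n) tnth v k 0 (tnth w k)].

Lemma tdot_tprod n (u v : n.-tuple 'rV[C]_d) :
  tdot (tprod u) (tprod v) =
  \prod_(k < n) \sum_(j < d) tnth u k 0 j * (tnth v k 0 j)^*%R.
Proof.
rewrite bigA_distr_bigA /tdot.
rewrite (reindex (fun f : {ffun 'I_n -> 'I_d} => [tuple f k | k < n])) /=.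
  apply: eq_bigr => f _; rewrite !ffunE rmorph_prod -big_split /=.
  by apply: eq_bigr => k _; rewrite tnth_mktuple.
exists (fun w : n.-tuple 'I_d => [ffun k => tnth w k]) => [f|w] _.
  by apply/ffunP => k; rewrite ffunE tnth_mktuple.
by apply: eq_from_tnth => k; rewrite tnth_mktuple ffunE.
Qed.

Lemma tensor_scaleE n a (x : V n) w : (a *: x) w = a * x w.
Proof. by rewrite ffunE. Qed.

Lemma tdotDl n (x y z : V n) : tdot (x + y) z = tdot x z + tdot y z.
Proof. by rewrite -big_split; apply: eq_bigr => w _; rewrite ffunE mulrDl. Qed.

Lemma tdotZl n a (x z : V n) : tdot (a *: x) z = a * tdot x z.
Proof. by rewrite mulr_sumr; apply: eq_bigr => w _; rewrite ffunE -mulrA. Qed.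

Lemma tdotC n (x y : V n) : tdot x y = (tdot y x)^*%R.
Proof.
rewrite rmorph_sum; apply: eq_bigr => w _.
by rewrite rmorphM /= conjCK mulrC.
Qed.

Lemma tdotDr n (x y z : V n) : tdot z (x + y) = tdot z x + tdot z y.
Proof. by rewrite tdotC tdotDl rmorphD /= -!tdotC. Qed.

Lemma tdotZr n a (x z : V n) : tdot z (a *: x) = a^*%R * tdot z x.
Proof. by rewrite tdotC tdotZl rmorphM /= -tdotC. Qed.

Lemma tdot0l n (z : V n) : tdot 0 z = 0.
Proof. by rewrite -(scale0r 0) tdotZl mul0r. Qed.

Lemma tdot0r n (z : V n) : tdot z 0 = 0.
Proof. by rewrite tdotC tdot0l rmorph0. Qed.

Lemma tdot_ge0 n (x : V n) : 0 <= tdot x x.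
Proof. by apply: sumr_ge0 => w _; exact: mul_conjC_ge0. Qed.

Definition tnorm2 n (x : V n) : R := Re (tdot x x).

Lemma tdotE n (x : V n) : tdot x x = (tnorm2 x)%:C.
Proof. by rewrite /tnorm2 RRe_real // ger0_real // tdot_ge0. Qed.

Lemma tnorm2_ge0 n (x : V n) : 0 <= tnorm2 x.
Proof. by rewrite -(lecR 0) -tdotE tdot_ge0. Qed.

Lemma tnorm2_eq0 n (x : V n) : tnorm2 x = 0 -> x = 0.
Proof.
move=> x0; have /eqP : tdot x x = 0 by rewrite tdotE x0.
rewrite psumr_eq0 => [/allP x0' |w _]; last exact: mul_conjC_ge0.
apply/ffunP => w; rewrite ffunE; apply/eqP; rewrite -mul_conjC_eq0.
by apply: x0'; rewrite mem_index_enum.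
Qed.

Lemma tnorm20 n : tnorm2 (0 : V n) = 0.
Proof. by rewrite /tnorm2 tdot0l. Qed.

Lemma tnorm2D n (x y : V n) :
  tnorm2 (x + y) = tnorm2 x + tnorm2 y + 2 * Re (tdot x y).
Proof.
rewrite /tnorm2 tdotDl !tdotDr (tdotC y x).
case: (tdot x x) (tdot y y) (tdot x y) => [a b] [a' b'] [e f] /=; lra.
Qed.

Lemma tnorm2Z n a (x : V n) : tnorm2 (a *: x) = (Re a ^+ 2 + Im a ^+ 2) * tnorm2 x.
Proof.
apply: (@complexI R); rewrite -tdotE tdotZl tdotZr tdotE mulrA -normCK.
by rewrite rmorphM /= add_Re2_Im2.
Qed.

Lemma tnorm2N n (x : V n) : tnorm2 (- x) = tnorm2 x.
Proof.
rewrite -scaleN1r tnorm2Z -[RHS]mul1r; congr (_ * _).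
by rewrite /= oppr0 expr0n addr0 sqrrN expr1n.
Qed.

Lemma Re_tdot_le n (x y : V n) : `|Re (tdot x y)| <= tnorm2 x + tnorm2 y.
Proof.
have h1 := tnorm2_ge0 (x + y); have h2 := tnorm2_ge0 (x - y).
move: h1 h2; rewrite !tnorm2D tnorm2N.
have -> : Re (tdot x (- y)) = - Re (tdot x y).
  by rewrite -scaleN1r tdotZr rmorphN rmorph1 mulN1r; case: (tdot x y).
move=> h1 h2; have := tnorm2_ge0 x; have := tnorm2_ge0 y => hx hy.
by rewrite ler_norml; apply/andP; split; lra.
Qed.

Lemma Im_tdot_le n (x y : V n) : `|Im (tdot x y)| <= tnorm2 x + tnorm2 y.
Proof.
have := Re_tdot_le ('i%C *: x) y.
by rewrite tdotZl mulrC ReiNIm normrN tnorm2Z /= expr0n expr1n add0r mul1r.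
Qed.

Lemma tnorm2D_le n (x y : V n) : tnorm2 (x + y) <= 2 * (tnorm2 x + tnorm2 y).
Proof.
rewrite tnorm2D; have := Re_tdot_le x y; rewrite ler_norml => /andP[_ h].
have h2 := tnorm2_ge0 (x - y); move: h2; rewrite tnorm2D tnorm2N.
have -> : Re (tdot x (- y)) = - Re (tdot x y).
  by rewrite -scaleN1r tdotZr rmorphN rmorph1 mulN1r; case: (tdot x y).
move=> h2; lra.
Qed.

End TensorPower.

Section FockSpace.
Variables (R : realType) (d : nat).
Local Notation C := R[i].
Local Notation V n := (tensor_power R d n).

(* the Hilbert space direct sum of the (C^d)^{(x)n}, n >= 0; (C^d)^{(x)0} is
   the space of functions on the one-element set of empty tuples, i.e. C *)
Record fock := Fock {
  fock_comp :> forall n, V n;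
  fock_sqsum : cvgn (series (fun n => tnorm2 (fock_comp n)))
}.

HB.instance Definition _ := gen_eqMixin fock.
HB.instance Definition _ := gen_choiceMixin fock.

Lemma fockP (x y : fock) : (forall n, x n = y n) -> x = y.
Proof.
case: x y => [x hx] [y hy] /= xy.
have {}xy : x = y by exact: functional_extensionality_dep.
by subst y; congr Fock; exact: Prop_irrelevance.
Qed.

Lemma fock_add_subproof (x y : fock) :
  cvgn (series (fun n => tnorm2 (x n + y n))).
Proof.
apply: (@series_le_cvg _ _ (2 *: ((fun n => tnorm2 (x n)) + (fun n => tnorm2 (y n))))).
- by move=> n; exact: tnorm2_ge0.
- by move=> n; rewrite mulr_ge0 // addr_ge0 // tnorm2_ge0.
- by move=> n; exact: tnorm2D_le.
- by apply: is_cvg_seriesZ; apply: is_cvg_seriesD; exact: fock_sqsum.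
Qed.

Lemma fock_scale_subproof a (x : fock) :
  cvgn (series (fun n => tnorm2 (a *: x n))).
Proof.
under eq_fun do rewrite tnorm2Z.
by apply: (@is_cvg_seriesZ _ _ (Re a ^+ 2 + Im a ^+ 2)); exact: fock_sqsum.
Qed.

Lemma fock_opp_subproof (x : fock) : cvgn (series (fun n => tnorm2 (- x n))).
Proof. by under eq_fun do rewrite tnorm2N; exact: fock_sqsum. Qed.

Lemma series_cst_near (W : zmodType) (u : nat -> W) N :
  (forall n, (N <= n)%N -> u n = 0) ->
  forall n, (N <= n)%N -> series u n = \sum_(k < N) u k.
Proof.
move=> u0 n Nn; rewrite seriesEnat /= (@big_cat_nat _ _ _ N) //= big_mkord.
rewrite [X in _ + X]big_nat_cond [X in _ + X]big1 ?addr0 // => k.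
by move=> /andP[/andP[/u0]].
Qed.

Lemma fin_sqsum N (x : forall n, V n) : (forall n, (N <= n)%N -> x n = 0) ->
  cvgn (series (fun n => tnorm2 (x n))).
Proof.
move=> x0; apply: (@cvgP _ _ (\sum_(k < N) tnorm2 (x k))); apply: cvg_near_cst.
exists N => // n Nn; apply: series_cst_near => // k Nk.
by rewrite x0 // tnorm20.
Qed.

Definition fock_zero : fock := Fock (@fin_sqsum 0 (fun=> 0) (fun _ _ => erefl)).
Definition fock_add x y : fock := Fock (@fock_add_subproof x y).
Definition fock_opp x : fock := Fock (@fock_opp_subproof x).
Definition fock_scale a x : fock := Fock (@fock_scale_subproof a x).

Lemma fock_addA : associative fock_add.
Proof. by move=> x y z; apply: fockP => n; exact: addrA. Qed.
Lemma fock_addC : commutative fock_add.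
Proof. by move=> x y; apply: fockP => n; exact: addrC. Qed.
Lemma fock_add0 : left_id fock_zero fock_add.
Proof. by move=> x; apply: fockP => n; exact: add0r. Qed.
Lemma fock_addN : left_inverse fock_zero fock_opp fock_add.
Proof. by move=> x; apply: fockP => n; exact: addNr. Qed.

HB.instance Definition _ :=
  GRing.isZmodule.Build fock fock_addA fock_addC fock_add0 fock_addN.

Lemma fock_scaleA a b x : fock_scale a (fock_scale b x) = fock_scale (a * b) x.
Proof. by apply: fockP => n; exact: scalerA. Qed.
Lemma fock_scale1 : left_id 1 fock_scale.
Proof. by move=> x; apply: fockP => n; exact: scale1r. Qed.
Lemma fock_scaleDr : right_distributive fock_scale +%R.
Proof. by move=> a x y; apply: fockP => n; exact: scalerDr. Qed.
Lemma fock_scaleDl x : {morph fock_scale^~ x : a b / a + b}.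
Proof. by move=> a b; apply: fockP => n; exact: scalerDl. Qed.

HB.instance Definition _ := GRing.Zmodule_isLmodule.Build C fock
  fock_scaleA fock_scale1 fock_scaleDr fock_scaleDl.

Definition fdot (x y : fock) : C :=
  limn (series (fun n => tdot (x n) (y n)) : nat -> C^o).

Lemma Re_series (u : nat -> C) n :
  Re (series u n) = series (fun k => Re (u k)) n.
Proof.
rewrite /series /=; elim: n => [|n IH]; first by rewrite !big_geq.
by rewrite !big_nat_recr //= -IH; case: (\sum_(0 <= k < n) _) (u n) => [? ?] [].
Qed.

Lemma Im_series (u : nat -> C) n :
  Im (series u n) = series (fun k => Im (u k)) n.
Proof.
rewrite /series /=; elim: n => [|n IH]; first by rewrite !big_geq.
by rewrite !big_nat_recr //= -IH; case: (\sum_(0 <= k < n) _) (u n) => [? ?] [].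
Qed.

Lemma fdotP (x y : fock) :
  (series (fun n => tdot (x n) (y n)) : nat -> C^o) @ \oo --> (fdot x y : C^o).
Proof.
have cv (f : C -> R) : (forall n, `|f (tdot (x n) (y n))| <=
    tnorm2 (x n) + tnorm2 (y n)) -> cvgn (series (fun n => f (tdot (x n) (y n)))).
  move=> fle; apply: normed_cvg.
  apply: (@series_le_cvg _ _ ((fun n => tnorm2 (x n)) + (fun n => tnorm2 (y n)))).
  - by move=> n /=.
  - by move=> n; rewrite addr_ge0 // tnorm2_ge0.
  - by move=> n; exact: fle.
  - by apply: is_cvg_seriesD; exact: fock_sqsum.
have cr := cv (@complex.Re R) (fun n => Re_tdot_le _ _).
have ci := cv (@complex.Im R) (fun n => Im_tdot_le _ _).
set l := Complex (limn (series (fun n => Re (tdot (x n) (y n)))))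
                 (limn (series (fun n => Im (tdot (x n) (y n))))).
suff ul : (series (fun n => tdot (x n) (y n)) : nat -> C^o) @ \oo --> (l : C^o).
  by apply/cvg_ex; exists l.
apply: cvg_complex => /=.
  by under eq_fun do rewrite Re_series.
by under eq_fun do rewrite Im_series.
Qed.

Lemma fdot_unique (x y : fock) (l : C) :
  (series (fun n => tdot (x n) (y n)) : nat -> C^o) @ \oo --> (l : C^o) ->
  fdot x y = l.
Proof. by apply: (@cvg_lim C^o); exact: norm_hausdorff. Qed.

Lemma fock_addE x y n : (x + y : fock) n = x n + y n. Proof. by []. Qed.
Lemma fock_oppE x n : (- x : fock) n = - x n. Proof. by []. Qed.
Lemma fock_scaleE a x n : (a *: x : fock) n = a *: x n. Proof. by []. Qed.
Lemma fock_zeroE n : (0 : fock) n = 0. Proof. by []. Qed.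

Lemma fock_sumE I (r : seq I) (P : pred I) (F : I -> fock) n :
  (\sum_(i <- r | P i) F i) n = \sum_(i <- r | P i) F i n.
Proof. by elim/big_rec2: _ => // i y1 y2 _ <-. Qed.

Lemma fdotDl (x y z : fock) : fdot (x + y) z = fdot x z + fdot y z.
Proof.
apply: fdot_unique.
rewrite (_ : series _ = series (fun n => tdot (x n) (z n)) +
                        series (fun n => tdot (y n) (z n))).
  by apply: (@cvgD _ C^o); exact: fdotP.
by rewrite -seriesD; congr series; apply/funext => n /=; rewrite tdotDl.
Qed.

Lemma fdotZl a (x z : fock) : fdot (a *: x) z = a * fdot x z.
Proof.
apply: fdot_unique.
rewrite (_ : series _ = a *: (series (fun n => tdot (x n) (z n)) : nat -> C^o)).
  by apply: (@cvgZr _ C^o); exact: fdotP.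
by rewrite -seriesZ; congr series; apply/funext => n /=; rewrite tdotZl.
Qed.

Lemma fdotBl (x y z : fock) : fdot (x - y) z = fdot x z - fdot y z.
Proof. by rewrite -scaleN1r fdotDl fdotZl mulN1r. Qed.

Lemma fdotC (x y : fock) : fdot x y = (fdot y x)^*%R.
Proof.
apply: fdot_unique.
rewrite (_ : series _ = (fun n => (series (fun n => tdot (y n) (x n)) n)^*%R)).
  by apply: cvg_conjc; exact: fdotP.
apply/funext => n; rewrite /series /= rmorph_sum.
by apply: eq_bigr => k _; rewrite tdotC.
Qed.

Lemma fdotDr (x y z : fock) : fdot z (x + y) = fdot z x + fdot z y.
Proof. by rewrite fdotC fdotDl rmorphD /= -!fdotC. Qed.

Lemma fdotZr a (x z : fock) : fdot z (a *: x) = a^*%R * fdot z x.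
Proof. by rewrite fdotC fdotZl rmorphM /= -fdotC. Qed.

Lemma fdot0l x : fdot 0 x = 0.
Proof. by rewrite -(scale0r 0) fdotZl mul0r. Qed.

Lemma fdot0r x : fdot x 0 = 0.
Proof. by rewrite fdotC fdot0l rmorph0. Qed.

Lemma fdot_tnorm2 (x : fock) :
  fdot x x = (limn (series (fun n => tnorm2 (x n))))%:C.
Proof.
apply: fdot_unique; apply: cvg_complex => /=.
  under eq_fun do rewrite Re_series; exact: fock_sqsum.
under eq_fun do rewrite Im_series.
rewrite (_ : series _ = fun=> 0); first exact: cvg_cst.
apply/funext => n; rewrite /series /= big1 // => k _.
by rewrite tdotE.
Qed.

Lemma tnorm2_le_fdot (x : fock) N :
  (\sum_(k < N) tnorm2 (x k))%:C <= fdot x x.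
Proof.
rewrite fdot_tnorm2 lecR -(big_mkord xpredT (fun k => tnorm2 (x k))).
apply: nondecreasing_cvgn_le; last exact: fock_sqsum.
by apply: nondecreasing_series => k _ _; exact: tnorm2_ge0.
Qed.

Lemma fdot_gt0 (x : fock) : x != 0 -> 0 < fdot x x.
Proof.
move=> x0; have [n xn] : exists n, x n != 0.
  apply: contra_notP (negP x0) => h; apply/eqP/fockP => n.
  by apply: contra_notP h => /eqP ?; exists n.
apply: lt_le_trans (tnorm2_le_fdot x n.+1); rewrite ltcR.
rewrite big_ord_recr /= ltr_wpDl ?sumr_ge0 // => [k _|]; first exact: tnorm2_ge0.
rewrite lt_neqAle tnorm2_ge0 andbT eq_sym.
by apply: contra xn => /eqP/tnorm2_eq0/eqP.
Qed.

Lemma fdot_bilinear : bilinear_for *%R (Num.conj \; *%R) fdot.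
Proof.
by split=> z a x y; rewrite ?(fdotDl, fdotDr) ?(fdotZl, fdotZr).
Qed.

Lemma fdot_hermitian (x y : fock) : fdot x y = (-1) ^+ false * (fdot y x)^*%R.
Proof. by rewrite expr0 mul1r fdotC. Qed.

HB.instance Definition _ := bilinear_isBilinear.Build C fock fock C *%R
  (Num.conj \; *%R) fdot fdot_bilinear.
HB.instance Definition _ :=
  isHermitianSesquilinear.Build C fock false Num.conj fdot fdot_hermitian.
HB.instance Definition _ := isDotProduct.Build C fock fdot fdot_gt0.

Definition fnorm (x : fock) : R := Num.sqrt (Re (fdot x x)).

Lemma fnorm_ge0 x : 0 <= fnorm x. Proof. exact: sqrtr_ge0. Qed.

Lemma fdot_ge0 x : 0 <= fdot x x.
Proof.
by have [->|/fdot_gt0/ltW//] := eqVneq x 0; rewrite fdot0l.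
Qed.

Lemma fnorm_sqr x : (fnorm x ^+ 2)%:C = fdot x x.
Proof.
have h := fdot_ge0 x.
have e : (Re (fdot x x))%:C = fdot x x by rewrite RRe_real // ger0_real.
by rewrite sqr_sqrtr // -(lecR 0) e.
Qed.

Lemma fdot_CauchySchwarz x y : `|fdot x y| <= (fnorm x * fnorm y)%:C.
Proof.
rewrite -(@ler_pXn2r _ 2) ?nnegrE // ?(lecR 0) ?mulr_ge0 ?fnorm_ge0 //.
have -> : (fnorm x * fnorm y)%:C ^+ 2 = fdot x x * fdot y y.
  by rewrite -!fnorm_sqr -rmorphXn exprMn rmorphM.
have [->|y0] := eqVneq y 0; first by rewrite !fdot0r normr0 expr0n mulr0.
have yy := fdot_gt0 y0.
set a := fdot x y; set b := fdot y y in yy *; set c := fdot x x.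
have cb : b^*%R = b by rewrite -fdotC.
have := fdot_ge0 (x + (- (a / b)) *: y).
rewrite fdotDl !fdotDr !fdotZl !fdotZr (fdotC y x) -/a -/b -/c.
have -> : (- (a / b))^*%R = - (a^*%R / b) by rewrite -[in RHS]cb -fmorphV -rmorphM -rmorphN.
rewrite normCK.
have -> : c + - (a^*%R / b) * a +
    (- (a / b) * a^*%R + - (a / b) * (- (a^*%R / b) * b)) = c - a * a^*%R / b.
  by field; rewrite gt_eqF.
by rewrite subr_ge0 ler_pdivrMr.
Qed.


Definition embed_comp n (v : V n) m : V m :=
  [ffun w : m.-tuple 'I_d =>
     if (insub (tval w) : option (n.-tuple 'I_d)) is Some w' then v w'
     else 0 : C].

Lemma embed_comp_id n (v : V n) : embed_comp v n = v.
Proof. by apply/ffunP => w; rewrite ffunE valK. Qed.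

Lemma embed_comp_neq n (v : V n) m : m != n -> embed_comp v m = 0.
Proof.
move=> mn; apply/ffunP => w; rewrite !ffunE insubF //.
by rewrite size_tuple (negbTE mn).
Qed.

Lemma embed_comp_gt n (v : V n) m : (n.+1 <= m)%N -> embed_comp v m = 0.
Proof. by move=> nm; apply: embed_comp_neq; rewrite gtn_eqF. Qed.

(* the canonical embedding of (C^d)^{(x)n} in the direct sum *)
Definition embed n (v : V n) : fock := Fock (fin_sqsum (@embed_comp_gt n v)).

Lemma embed_id n (v : V n) : embed v n = v.
Proof. exact: embed_comp_id. Qed.

Lemma embed_neq n (v : V n) m : m != n -> embed v m = 0.
Proof. exact: embed_comp_neq. Qed.

Lemma fdot_fin N (x y : fock) :
  (forall n, (N <= n)%N -> tdot (x n) (y n) = 0) ->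
  fdot x y = \sum_(n < N) tdot (x n) (y n).
Proof.
move=> xy0; apply: fdot_unique; apply: (@cvg_near_cst _ C^o).
by exists N => // n /=; exact: series_cst_near.
Qed.

Lemma fdot_embed x n (v : V n) : fdot x (embed v) = tdot (x n) v.
Proof.
rewrite (@fdot_fin n.+1) => [|m nm].
  rewrite big_ord_recr /= embed_comp_id big1 ?add0r // => k _.
  by rewrite embed_comp_neq ?tdot0r // ltn_eqF.
by rewrite embed_neq ?tdot0r // gtn_eqF.
Qed.

Definition basis n (w : n.-tuple 'I_d) : fock :=
  embed ([ffun w' => (w' == w)%:R] : V n).

Lemma fdot_basis x n (w : n.-tuple 'I_d) : fdot x (basis w) = x n w.
Proof.
rewrite fdot_embed /tdot (bigD1 w) //= ffunE eqxx conjC1 mulr1.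
by rewrite big1 ?addr0 // => w' ww'; rewrite ffunE (negbTE ww') conjC0 mulr0.
Qed.

Lemma trunc_gt N (x : forall n, V n) n : (N <= n)%N ->
  (if (n < N)%N then x n else 0) = 0.
Proof. by rewrite ltnNge => ->. Qed.

Definition trunc N (x : forall n, V n) : fock := Fock (fin_sqsum (@trunc_gt N x)).

Lemma fdot_truncl N (x : forall n, V n) (y : fock) :
  fdot (trunc N x) y = \sum_(n < N) tdot (x n) (y n).
Proof.
rewrite (@fdot_fin N) => [|n Nn]; last by rewrite /= trunc_gt // tdot0l.
by apply: eq_bigr => k _; rewrite /= ltn_ord.
Qed.

Lemma embed_sum n (v : V n) :
  embed v = \sum_(w : n.-tuple 'I_d) v w *: basis w.
Proof.
apply: fockP => m; rewrite fock_sumE; apply/ffunP => u; rewrite sum_ffunE.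
have [mn|mn] := eqVneq m n.
  subst m; rewrite embed_id (bigD1 u) //= tensor_scaleE embed_comp_id ffunE.
  rewrite eqxx mulr1 big1 ?addr0 // => u' uu'.
  by rewrite tensor_scaleE embed_comp_id ffunE eq_sym (negbTE uu') mulr0.
rewrite embed_neq // big1 ?ffunE // => u' _.
by rewrite tensor_scaleE /basis embed_neq // ffunE mulr0.
Qed.

Lemma trunc_sum N (x : forall n, V n) :
  trunc N x = \sum_(n < N) embed (x n).
Proof.
apply: fockP => m; rewrite fock_sumE /=; case: ltnP => mN.
  rewrite (bigD1 (Ordinal mN)) //= embed_comp_id big1 ?addr0 // => i im.
  by rewrite embed_comp_neq // eq_sym.
by rewrite big1 // => i _; rewrite embed_comp_neq // gtn_eqF // (leq_trans _ mN).
Qed.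

End FockSpace.

Section BoundedOperators.
Variables (R : realType) (d : nat).
Local Notation C := R[i].
Local Notation V n := (tensor_power R d n).
Local Notation H := (fock R d).

Record bop := Bop {
  bop_fun :> H -> H;
  bop_linear : linear bop_fun;
  bop_bounded : exists M : R, forall x, fnorm (bop_fun x) <= M * fnorm x
}.

HB.instance Definition _ (A : bop) :=
  GRing.isLinear.Build C H H *:%R A (bop_linear A).

HB.instance Definition _ := gen_eqMixin bop.
HB.instance Definition _ := gen_choiceMixin bop.

Lemma bopP (A B : bop) : (forall x, A x = B x) -> A = B.
Proof.
case: A B => [A lA bA] [B lB bB] /= AB.
have {}AB : A = B by exact/funext.
by subst B; congr Bop; exact: Prop_irrelevance.
Qed.

Lemma fnormN (x : H) : fnorm (- x) = fnorm x.
Proof.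
by rewrite /fnorm -scaleN1r fdotZl fdotZr rmorphN rmorph1 !mulN1r opprK.
Qed.

Lemma fnorm_sqrE (x : H) : fnorm x ^+ 2 = Re (fdot x x).
Proof. by rewrite -fnorm_sqr. Qed.

Lemma fnormD (x y : H) : fnorm (x + y) <= fnorm x + fnorm y.
Proof.
have h : 0 <= fnorm x + fnorm y by rewrite addr_ge0 // fnorm_ge0.
rewrite -(@ler_pXn2r _ 2) ?nnegrE ?fnorm_ge0 //.
have xy : Re (fdot x y) <= fnorm x * fnorm y.
  apply: le_trans (ler_norm _) _; rewrite -lecR.
  exact: le_trans (normc_ge_Re _) (fdot_CauchySchwarz _ _).
have -> : fnorm (x + y) ^+ 2 = fnorm x ^+ 2 + fnorm y ^+ 2 + 2 * Re (fdot x y).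
  rewrite !fnorm_sqrE fdotDl !fdotDr (fdotC y x).
  by case: (fdot x x) (fdot y y) (fdot x y) => [a b] [a' b'] [e f] /=; lra.
by rewrite sqrrD; lra.
Qed.

Lemma bop_bound_ge0 (A : bop) :
  exists2 M : R, 0 <= M & forall x, fnorm (A x) <= M * fnorm x.
Proof.
have [M MA] := bop_bounded A; exists (Num.max M 0); first by rewrite le_max lexx orbT.
by move=> x; apply: le_trans (MA x) _; rewrite ler_wpM2r ?fnorm_ge0 // le_max lexx.
Qed.

Lemma zero_linear : linear (fun _ : H => 0 : H).
Proof. by move=> a x y; rewrite scaler0 addr0. Qed.

Lemma zero_bounded : exists M : R, forall x : H, fnorm (0 : H) <= M * fnorm x.
Proof. by exists 0 => x; rewrite mul0r /fnorm fdot0l sqrtr0. Qed.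

Lemma id_linear : linear (fun x : H => x). Proof. by []. Qed.

Lemma id_bounded : exists M : R, forall x : H, fnorm x <= M * fnorm x.
Proof. by exists 1 => x; rewrite mul1r. Qed.

Section Operations.
Variables A B : bop.

Lemma opp_linear : linear (fun x => - A x).
Proof. by move=> a x y; rewrite linearP opprD scalerN. Qed.

Lemma opp_bounded : exists M : R, forall x, fnorm (- A x) <= M * fnorm x.
Proof.
have [M _ MA] := bop_bound_ge0 A; exists M => x.
by rewrite fnormN.
Qed.

Lemma add_linear : linear (fun x => A x + B x).
Proof. by move=> a x y; rewrite !linearP scalerDr addrACA. Qed.

Lemma add_bounded : exists M : R, forall x, fnorm (A x + B x) <= M * fnorm x.
Proof.
have [M _ MA] := bop_bound_ge0 A; have [N _ NB] := bop_bound_ge0 B.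
exists (M + N) => x; apply: le_trans (fnormD _ _) _.
by rewrite mulrDl lerD.
Qed.

Lemma comp_linear : linear (fun x => A (B x)).
Proof. by move=> a x y; rewrite !linearP. Qed.

Lemma comp_bounded : exists M : R, forall x, fnorm (A (B x)) <= M * fnorm x.
Proof.
have [M M0 MA] := bop_bound_ge0 A; have [N _ NB] := bop_bound_ge0 B.
exists (M * N) => x; apply: le_trans (MA _) _.
by rewrite -mulrA ler_wpM2l.
Qed.

End Operations.

Definition bop_zero : bop := Bop zero_linear zero_bounded.
Definition bop_one : bop := Bop id_linear id_bounded.
Definition bop_opp A : bop := Bop (@opp_linear A) (@opp_bounded A).
Definition bop_add A B : bop := Bop (@add_linear A B) (@add_bounded A B).
Definition bop_mul A B : bop := Bop (@comp_linear A B) (@comp_bounded A B).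

Lemma bop_addA : associative bop_add.
Proof. by move=> A B D; apply: bopP => x; exact: addrA. Qed.
Lemma bop_addC : commutative bop_add.
Proof. by move=> A B; apply: bopP => x; exact: addrC. Qed.
Lemma bop_add0 : left_id bop_zero bop_add.
Proof. by move=> A; apply: bopP => x; exact: add0r. Qed.
Lemma bop_addN : left_inverse bop_zero bop_opp bop_add.
Proof. by move=> A; apply: bopP => x; exact: addNr. Qed.

HB.instance Definition _ :=
  GRing.isZmodule.Build bop bop_addA bop_addC bop_add0 bop_addN.

Lemma bop_mulA : associative bop_mul.
Proof. by move=> A B D; apply: bopP. Qed.
Lemma bop_mul1l : left_id bop_one bop_mul.
Proof. by move=> A; apply: bopP. Qed.
Lemma bop_mul1r : right_id bop_one bop_mul.
Proof. by move=> A; apply: bopP. Qed.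
Lemma bop_mulDl : left_distributive bop_mul +%R.
Proof. by move=> A B D; apply: bopP. Qed.
Lemma bop_mulDr : right_distributive bop_mul +%R.
Proof. by move=> A B D; apply: bopP => x /=; rewrite linearD. Qed.

HB.instance Definition _ := GRing.Zmodule_isPzRing.Build bop
  bop_mulA bop_mul1l bop_mul1r bop_mulDl bop_mulDr.

Lemma fdot_lim (x y : H) :
  ((fun N => fdot (trunc N x) y) : nat -> C^o) @ \oo --> (fdot x y : C^o).
Proof.
rewrite (_ : (fun _ => _) = series (fun n => tdot (x n) (y n))); first exact: fdotP.
by apply/funext => N; rewrite fdot_truncl /series /= big_mkord.
Qed.

Lemma fnorm_trunc (x : H) :
  (fun N => fnorm (x - trunc N x) ^+ 2) @ \oo --> (0 : R).
Proof.
rewrite (_ : (fun _ => _) = fun N => fnorm x ^+ 2 - Re (fdot (trunc N x) x)).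
  have c : (fun _ : nat => fnorm x ^+ 2) @ \oo --> fnorm x ^+ 2 by exact: cvg_cst.
  rewrite -(subrr (fnorm x ^+ 2)) [X in _ - X]fnorm_sqrE.
  apply: cvgB c _.
  by apply: (cvg_Re (u := fun N => fdot (trunc N x) x)); exact: fdot_lim.
apply/funext => N.
have e : fdot (trunc N x) (trunc N x) = fdot (trunc N x) x.
  rewrite !fdot_truncl; apply: eq_bigr => k _.
  by rewrite /= ltn_ord.
rewrite !fnorm_sqrE -scaleN1r fdotDl !fdotDr !fdotZl !fdotZr e.
rewrite (fdotC x (trunc N x)) rmorphN rmorph1 !mulN1r opprK.
by case: (fdot x x) (fdot (trunc N x) x) => [a b] [a' b'] /=; lra.
Qed.

Section Adjoint.
Variable A : bop.

Definition adj_comp (y : H) n : V n :=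
  [ffun w : n.-tuple 'I_d => (fdot (A (basis R w)) y)^*%R].

Lemma fdot_trunc_adj N (x : forall n, V n) (y : H) :
  fdot (A (trunc N x)) y = \sum_(n < N) tdot (x n) (adj_comp y n).
Proof.
have fdot_suml I (r : seq I) (F : I -> H) z :
  fdot (\sum_(i <- r) F i) z = \sum_(i <- r) fdot (F i) z.
  by elim/big_rec2: _ => [|i u v _ <-]; rewrite ?fdot0l ?fdotDl.
rewrite trunc_sum linear_sum fdot_suml; apply: eq_bigr => n _.
rewrite embed_sum linear_sum fdot_suml; apply: eq_bigr => w _.
by rewrite linearZ /= fdotZl ffunE conjCK.
Qed.

Lemma adj_sqsum_le M (y : H) N : 0 <= M ->
    (forall x, fnorm (A x) <= M * fnorm x) ->
  \sum_(n < N) tnorm2 (adj_comp y n) <= (M * fnorm y) ^+ 2.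
Proof.
move=> M0 MA; set s := \sum_(n < N) _.
set z := trunc N (adj_comp y).
have sE (u : C) : u = \sum_(n < N) tdot (adj_comp y n) (adj_comp y n) -> u = s%:C.
  by move=> ->; rewrite rmorph_sum; apply: eq_bigr => k _; rewrite tdotE.
have Az : fdot (A z) y = s%:C by apply: sE; rewrite fdot_trunc_adj.
have zz : fnorm z ^+ 2 = s.
  apply: (@complexI R); rewrite fnorm_sqr; apply: sE.
  by rewrite fdot_truncl; apply: eq_bigr => k _; rewrite /= ltn_ord.
have s0 : 0 <= s by rewrite -zz sqr_ge0.
have := fdot_CauchySchwarz (A z) y.
rewrite Az ger0_norm ?(lecR 0) // lecR => h.
have {}h : s <= M * fnorm z * fnorm y.
  by apply: le_trans h _; rewrite ler_wpM2r ?fnorm_ge0.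
have {}h : fnorm z * fnorm z <= M * fnorm y * fnorm z by rewrite -expr2 zz; lra.
have [z0|zn0] := eqVneq (fnorm z) 0.
  by rewrite -zz z0 expr0n /= sqr_ge0.
rewrite ler_pM2r ?lt_neqAle ?fnorm_ge0 1?eq_sym ?zn0 // in h.
by rewrite -zz ler_pXn2r // nnegrE ?fnorm_ge0 // mulr_ge0 // fnorm_ge0.
Qed.

Lemma adj_sqsum (y : H) : cvgn (series (fun n => tnorm2 (adj_comp y n))).
Proof.
have [M M0 MA] := bop_bound_ge0 A.
apply: nondecreasing_is_cvgn.
  by apply: nondecreasing_series => n _ _; exact: tnorm2_ge0.
exists ((M * fnorm y) ^+ 2) => _ [N _ <-].
by rewrite /series /= big_mkord adj_sqsum_le.
Qed.

Definition adj_fun (y : H) : H := Fock (@adj_sqsum y).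

Lemma adj_linear : linear adj_fun.
Proof.
move=> a y z; apply: fockP => n; apply/ffunP => w.
have -> : (a *: adj_fun y + adj_fun z) n w = a * adj_comp y n w + adj_comp z n w.
  by rewrite ffunE tensor_scaleE.
rewrite !ffunE.
rewrite fdotDr fdotZr rmorphD rmorphM /=; congr (_ * _ + _).
exact: conjCK.
Qed.

Lemma adj_bounded : exists M : R, forall x, fnorm (adj_fun x) <= M * fnorm x.
Proof.
have [M M0 MA] := bop_bound_ge0 A; exists M => y.
have My0 : 0 <= M * fnorm y by rewrite mulr_ge0 ?fnorm_ge0.
rewrite -(@ler_pXn2r _ 2) ?nnegrE ?fnorm_ge0 //.
rewrite fnorm_sqrE fdot_tnorm2 /=; apply: limr_le; first exact: adj_sqsum.
by apply: nearW => N; rewrite /series /= big_mkord adj_sqsum_le.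
Qed.

Lemma adj_fun_adj (x y : H) : fdot (A x) y = fdot x (adj_fun y).
Proof.
have [M M0 MA] := bop_bound_ge0 A.
apply/esym; apply: fdot_unique.
rewrite (_ : series _ = (fun N => fdot (A (trunc N x)) y)); last first.
  by apply/funext => N; rewrite fdot_trunc_adj /series /= big_mkord.
apply/(@cvgrPdist_lt _ C^o) => e /RRe_gt0[r r0 ->].
have K0 : 0 < (M * fnorm y) ^+ 2 + 1 by rewrite ltr_wpDl ?sqr_ge0.
have r2 : 0 < r ^+ 2 / ((M * fnorm y) ^+ 2 + 1) by rewrite divr_gt0 ?exprn_gt0.
have /cvgrPdist_lt/(_ _ r2) := fnorm_trunc x; apply: filterS => N /=.
rewrite sub0r normrN ger0_norm ?sqr_ge0 // ltr_pdivlMr // => h.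
have -> : fdot (A x) y - fdot (A (trunc N x)) y = fdot (A (x - trunc N x)) y.
  by rewrite linearB fdotBl.
apply: le_lt_trans (fdot_CauchySchwarz _ _) _; rewrite ltcR.
set t := fnorm (x - trunc N x) in h *.
have t0 : 0 <= t by exact: fnorm_ge0.
apply: le_lt_trans (_ : M * t * fnorm y < r).
  by rewrite ler_wpM2r ?fnorm_ge0.
rewrite -(@ltr_pXn2r _ 2) ?nnegrE ?mulr_ge0 ?fnorm_ge0 ?(ltW r0) //.
apply: le_lt_trans h; rewrite mulrAC exprMn mulrDr mulrC lerDl.
by rewrite mulr1 sqr_ge0.
Qed.

Lemma adj_exists : exists B : bop, forall x y : H, fdot (A x) y = fdot x (B y).
Proof. by exists (Bop adj_linear adj_bounded); exact: adj_fun_adj. Qed.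

Definition adj : bop := projT1 (cid adj_exists).

Lemma adjP (x y : H) : fdot (A x) y = fdot x (adj y).
Proof. exact: (projT2 (cid adj_exists)). Qed.

Lemma adj_unique (B : bop) :
  (forall x y : H, fdot (A x) y = fdot x (B y)) -> B = adj.
Proof.
move=> AB; apply: bopP => y; apply: fockP => n; apply/ffunP => w.
apply: (can_inj (@conjCK _)).
by rewrite -!fdot_basis -!fdotC -AB adjP.
Qed.

End Adjoint.

End BoundedOperators.

Section Creation.
Variables (R : realType) (d : nat).
Local Notation C := R[i].
Local Notation V n := (tensor_power R d n).
Local Notation H := (fock R d).

(* v (x) x and x (x) v, for v in C^d and x in (C^d)^{(x)n} *)
Definition tensl n (v : 'rV[C]_d) (x : V n) : V n.+1 :=
  [ffun w : n.+1.-tuple 'I_d => v 0 (thead w) * x (behead_tuple w)].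

Definition tensr n (v : 'rV[C]_d) (x : V n) : V n.+1 :=
  [ffun w : n.+1.-tuple 'I_d =>
     x [tuple tnth w (widen_ord (leqnSn n) k) | k < n] * v 0 (tnth w ord_max)].

Lemma tensl_tprod n (v : 'rV[C]_d) (u : n.-tuple 'rV[C]_d) :
  tensl v (tprod u) = tprod (cons_tuple v u).
Proof.
apply/ffunP => w; rewrite !ffunE big_ord_recl tnth0.
congr (v 0 _ * _); apply: eq_bigr => k _.
rewrite tnthS tnth_behead; congr (_ 0 (tnth w _)); apply: val_inj => /=.
by rewrite inordK ?ltnS.
Qed.

Lemma tensr_tprod n (v : 'rV[C]_d) (u : n.-tuple 'rV[C]_d) :
  tensr v (tprod u) = tprod (rcons_tuple u v).
Proof.
apply/ffunP => w; rewrite !ffunE big_ord_recr /=; congr (_ * _).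
  apply: eq_bigr => k _; rewrite tnth_mktuple; congr (_ 0 _).
  by rewrite !(tnth_nth 0) /= nth_rcons size_tuple ltn_ord.
by rewrite (tnth_nth 0) /= nth_rcons size_tuple ltnn eqxx.
Qed.

Lemma tensl_linear n v : linear (@tensl n v).
Proof.
by move=> a x y; apply/ffunP => w; rewrite !ffunE mulrDr mulrCA.
Qed.

Lemma tensr_linear n v : linear (@tensr n v).
Proof.
by move=> a x y; apply/ffunP => w; rewrite !ffunE mulrDl -mulrA.
Qed.

Lemma tdot_tensl n u v (x y : V n) :
  tdot (tensl u x) (tensl v y) = (\sum_j u 0 j * (v 0 j)^*%R) * tdot x y.
Proof.
rewrite /tdot big_distrlr pair_bigA /=.
rewrite (reindex (fun p : 'I_d * n.-tuple 'I_d => cons_tuple p.1 p.2)) /=.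
  apply: eq_bigr => -[j w] _ /=; rewrite !ffunE theadE.
  have -> : behead_tuple (cons_tuple j w) = w by apply: val_inj.
  by rewrite rmorphM /= mulrACA.
exists (fun w => (thead w, behead_tuple w)) => [[j w]|w] _ /=.
  by rewrite theadE; congr pair; apply: val_inj.
by apply: val_inj; case/tupleP: w.
Qed.

Lemma tdot_tensr n u v (x y : V n) :
  tdot (tensr u x) (tensr v y) = (\sum_j u 0 j * (v 0 j)^*%R) * tdot x y.
Proof.
rewrite /tdot big_distrlr pair_bigA /=.
have lastK j (w : n.-tuple 'I_d) : tnth (rcons_tuple w j) ord_max = j.
  by rewrite (tnth_nth j) /= nth_rcons size_tuple ltnn eqxx.
have belastK j (w : n.-tuple 'I_d) :
    [tuple tnth (rcons_tuple w j) (widen_ord (leqnSn n) k) | k < n] = w.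
  apply: eq_from_tnth => k; rewrite tnth_mktuple !(tnth_nth j) /= nth_rcons.
  by rewrite size_tuple ltn_ord.
rewrite (reindex (fun p : 'I_d * n.-tuple 'I_d => rcons_tuple p.2 p.1)) /=.
  apply: eq_bigr => -[j w] _ /=; rewrite !ffunE lastK belastK.
  by rewrite rmorphM /= mulrACA mulrC.
exists (fun w => (tnth w ord_max, [tuple tnth w (widen_ord (leqnSn n) k) | k < n]))
  => [[j w]|w] _ /=.
  by rewrite lastK belastK.
apply: eq_from_tnth => k; rewrite (tnth_nth (tnth w ord_max)) /= nth_rcons.
rewrite size_map size_enum_ord; have [kn|nk] := ltnP k n.
  rewrite (nth_map (Ordinal kn)) ?size_enum_ord //; congr tnth.
  by apply: val_inj; rewrite /= nth_enum_ord.
have -> : k = ord_max by apply/val_inj/anti_leq; rewrite /= nk -ltnS ltn_ord.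
by rewrite eqxx.
Qed.

Section Shift.
Variable F : forall n, V n -> V n.+1.
Hypothesis F_linear : forall n, linear (@F n).
Hypothesis F_tnorm2 : forall n (x : V n), tnorm2 (F x) = tnorm2 x.

Definition shift_comp (x : H) n : V n := if n is m.+1 then F (x m) else 0.

Lemma shift_sqsum_le (x : H) N :
  \sum_(n < N) tnorm2 (shift_comp x n) <= fnorm x ^+ 2.
Proof.
case: N => [|N]; first by rewrite big_ord0 sqr_ge0.
rewrite big_ord_recl /= tnorm20 add0r -lecR fnorm_sqr.
under eq_bigr do rewrite F_tnorm2.
exact: tnorm2_le_fdot.
Qed.

Lemma shift_sqsum (x : H) : cvgn (series (fun n => tnorm2 (shift_comp x n))).
Proof.
apply: nondecreasing_is_cvgn.
  by apply: nondecreasing_series => n _ _; exact: tnorm2_ge0.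
exists (fnorm x ^+ 2) => _ [N _ <-].
by rewrite /series /= big_mkord shift_sqsum_le.
Qed.

Definition shift_fun (x : H) : H := Fock (@shift_sqsum x).

Lemma shift_linear : linear shift_fun.
Proof.
move=> a x y; apply: fockP => -[|n] /=; first by rewrite scaler0 addr0.
exact: F_linear.
Qed.

Lemma shift_bounded : exists M : R, forall x, fnorm (shift_fun x) <= M * fnorm x.
Proof.
exists 1 => x; rewrite mul1r -(@ler_pXn2r _ 2) ?nnegrE ?fnorm_ge0 //.
rewrite [leLHS]fnorm_sqrE fdot_tnorm2 /=; apply: limr_le; first exact: shift_sqsum.
by apply: nearW => N; rewrite /series /= big_mkord shift_sqsum_le.
Qed.

Definition shift : bop R d := Bop shift_linear shift_bounded.

Lemma shift_embed n (x : V n) : shift (embed x) = embed (F x).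
Proof.
have F0 m : @F m 0 = 0 by apply: tnorm2_eq0; rewrite F_tnorm2 tnorm20.
apply: fockP => -[|m]; first by rewrite embed_neq.
have [<-|nm] := eqVneq n m; first by rewrite /= !embed_comp_id.
by rewrite /= !embed_comp_neq // 1?eq_sym // eqSS eq_sym.
Qed.

End Shift.

Definition std_basis (i : 'I_d) : 'rV[C]_d := delta_mx 0 i.

Lemma std_basis_norm i : \sum_j std_basis i 0 j * (std_basis i 0 j)^*%R = 1.
Proof.
rewrite (bigD1 i) //= !mxE !eqxx /= conjC1 mulr1 big1 ?addr0 // => j ji.
by rewrite !mxE (negbTE ji) /= mul0r.
Qed.

Lemma tnorm2_tensl i n (x : V n) : tnorm2 (tensl (std_basis i) x) = tnorm2 x.
Proof. by rewrite /tnorm2 tdot_tensl std_basis_norm mul1r. Qed.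

Lemma tnorm2_tensr i n (x : V n) : tnorm2 (tensr (std_basis i) x) = tnorm2 x.
Proof. by rewrite /tnorm2 tdot_tensr std_basis_norm mul1r. Qed.

Definition lcreation (i : 'I_d) : bop R d :=
  shift (fun n => @tensl_linear n (std_basis i)) (@tnorm2_tensl i).

Definition rcreation (i : 'I_d) : bop R d :=
  shift (fun n => @tensr_linear n (std_basis i)) (@tnorm2_tensr i).

Definition vacuum : H := embed ([ffun=> 1] : V 0).

Lemma vacuum_tprod : vacuum = embed (tprod [tuple]).
Proof.
by congr embed; apply/ffunP => w; rewrite !ffunE big_ord0.
Qed.

Lemma lcreation_embed i n (u : n.-tuple 'rV[C]_d) :
  lcreation i (embed (tprod u)) = embed (tprod (cons_tuple (std_basis i) u)).
Proof. by rewrite shift_embed tensl_tprod. Qed.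

Lemma rcreation_embed i n (u : n.-tuple 'rV[C]_d) :
  rcreation i (embed (tprod u)) = embed (tprod (rcons_tuple u (std_basis i))).
Proof. by rewrite shift_embed tensr_tprod. Qed.

Lemma lcreation_vacuum i : lcreation i vacuum = embed (tprod [tuple std_basis i]).
Proof.
rewrite vacuum_tprod lcreation_embed; congr (embed (tprod _)); exact: val_inj.
Qed.

Lemma rcreation_vacuum i : rcreation i vacuum = embed (tprod [tuple std_basis i]).
Proof.
rewrite vacuum_tprod rcreation_embed; congr (embed (tprod _)); exact: val_inj.
Qed.

Definition vacuum_state (X : bop R d) : C := fdot (X vacuum) vacuum.

(* sums, products and powers are those of the ring bop, whose product is
   composition *)
Definition fock_T : bop R d :=
  \sum_(i < d) (lcreation i + adj (lcreation i)) * (rcreation i + adj (rcreation i)).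

End Creation.

Arguments fock_T : clear implicits.

(* Main.v *)
(* Let X_i = L_i + L_i^* and Y_i = R_i + R_i^*. The X_i commute with the Y_j, so
   each X_i Y_i is self-adjoint; and since Y_i and X_i agree on the vacuum,
   T^n applied to the vacuum is the sum over words w of length n of
   X_{w_1} ... X_{w_n} X_{w_n} ... X_{w_1} applied to the vacuum. The vacuum
   state of a product of X's indexed by a word of length 2n counts the
   non-crossing pairings whose blocks join equal letters: reading the word,
   each letter either opens an arch or closes the last open one. A word
   colours a meandric system, the palindromes being the words constant on the
   rainbow, and the colourings compatible with both halves are those constant
   on the blocks of the join: d to the number of components. *)
Require Import Defs.
From mathcomp Require Import all_boot all_order all_algebra complex.
From mathcomp Require Import zify.
Import GRing.Theory Num.Theory.
Local Open Scope ring_scope.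
Set Implicit Arguments.
Unset Strict Implicit.
Unset Printing Implicit Defensive.

(** * Colourings constant on the blocks of a partition *)

Section Monochromatic.
Variables (T : finType).
Implicit Types P Q J : {set {set T}}.

Definition monochromatic (U : eqType) (c : T -> U) P :=
  [forall B in P, forall x in B, forall y in B, c x == c y].

Lemma monochromaticP (U : eqType) (c : T -> U) P :
  reflect (forall B x y, B \in P -> x \in B -> y \in B -> c x = c y)
          (monochromatic c P).
Proof.
apply: (iffP forall_inP) => [h B x y BP xB yB|h B BP].
  by have /forall_inP/(_ x xB)/forall_inP/(_ y yB)/eqP := h B BP.
by apply/forall_inP => x xB; apply/forall_inP => y yB; apply/eqP; exact: h BP _ _.
Qed.

Lemma eq_monochromatic (U : eqType) (c c' : T -> U) P :
  c =1 c' -> monochromatic c P = monochromatic c' P.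
Proof.
move=> cc'; rewrite /monochromatic; apply: eq_forallb => B; congr (_ ==> _).
by apply: eq_forallb => x; congr (_ ==> _); apply: eq_forallb => y; rewrite !cc'.
Qed.

Lemma monochromatic_refines (U : eqType) (c : T -> U) P Q :
  refines P Q -> monochromatic c Q -> monochromatic c P.
Proof.
move=> /forall_inP PQ /monochromaticP cQ; apply/monochromaticP => B x y BP xB yB.
have /exists_inP[D DQ /subsetP BD] := PQ B BP.
by apply: cQ DQ _ _; exact: BD.
Qed.

(** Turns the colouring condition into an inequality of partitions, bounded by the fibres of [c], to
    which the universal property of the join applies. *)
Lemma monochromatic_refinesE (U : eqType) (c : T -> U) P :
  partition P [set: T] ->
  monochromatic c P = refines P (preim_partition c [set: T]).
Proof.
move=> pP; have [/eqP cP _ P0] := and3P pP.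
have eqv : {in [set: T] & &, equivalence_rel [rel x y | c x == c y]}.
  by move=> x y z _ _ _; split=> //= /eqP->.
apply/monochromaticP/forall_inP => [h B BP|h B x y BP xB yB]; last first.
  have /exists_inP[D DQ /subsetP BD] := h B BP.
  have [/eqP _ tQ _] := and3P (preim_partitionP c [set: T]).
  have := pblock_equivalence_partition eqv (in_setT x) (in_setT y).
  by rewrite (def_pblock tQ DQ (BD _ xB)) BD // => /esym/eqP.
have /set0Pn[x xB] : B != set0 by apply: contraNneq P0 => <-.
apply/existsP; exists [set y in [set: T] | c x == c y]; apply/andP; split.
  by apply/imsetP; exists x.
by apply/subsetP => y yB; rewrite !inE /=; apply/eqP; exact: h BP xB yB.
Qed.

Lemma monochromatic_pjoin (U : eqType) (c : T -> U) P Q :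
  partition P [set: T] -> partition Q [set: T] ->
  monochromatic c (pjoin P Q) = monochromatic c P && monochromatic c Q.
Proof.
move=> pP pQ; have /and4P[pJ PJ QJ /forallP lubJ] := pjoinP pP pQ.
apply/idP/andP => [cJ|[]].
  by split; apply: monochromatic_refines cJ.
rewrite !monochromatic_refinesE // => cP cQ; apply: (implyP (lubJ _)).
by rewrite preim_partitionP cP.
Qed.

(** [lift] identifies these colourings with the functions from the blocks of [J] to the colours; its
    inverse reads the colour at a chosen point of each block. *)
Lemma card_monochromatic d J : partition J [set: T] ->
  #|[set c : {ffun T -> 'I_d} | monochromatic c J]| = (d ^ #|J|)%N.
Proof.
move=> pJ; have [/eqP cJ tJ J0] := and3P pJ.
have memJ x : pblock J x \in J by rewrite pblock_mem // cJ inE.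
have neJ (B : {B | B \in J}) : exists x, x \in val B.
  by apply/set0Pn; apply: contraNneq J0 => <-; exact: valP.
pose block x : {B | B \in J} := Sub (pblock J x) (memJ x).
have blockE x (B : {B | B \in J}) : x \in val B -> block x = B.
  by move=> xB; apply: val_inj; rewrite /= (def_pblock tJ (valP B)).
pose lift (g : {ffun {B | B \in J} -> 'I_d}) : {ffun T -> 'I_d} :=
  [ffun x => g (block x)].
have lift_inj : injective lift.
  move=> g h /ffunP gh; apply/ffunP => B; have [x xB] := neJ B.
  by have := gh x; rewrite !ffunE (blockE x B).
transitivity #|[set lift g | g in {ffun {B | B \in J} -> 'I_d}]|; last first.
  by rewrite card_imset // card_ffun card_ord card_sig.
apply: eq_card => c; rewrite inE; apply/monochromaticP/imsetP; last first.
  move=> [g _ ->] B x y BJ xB yB; rewrite !ffunE; congr (g _).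
  by rewrite (blockE x (Sub B BJ)) // (blockE y (Sub B BJ)).
move=> h; exists [ffun B => c (xchoose (neJ B))] => //.
apply/ffunP => x; rewrite !ffunE; apply: (h (pblock J x)) => //.
  by rewrite mem_pblock cJ inE.
exact: (xchooseP (neJ (block x))).
Qed.

End Monochromatic.

(** Pairings are grouped by their number of components. The sum over [k] starts at 1, so [n = 0],
    where the empty join has no component, is excluded. *)
Lemma semi_meander_polyE n (t : int) : (0 < n)%N -> (semi_meander_poly n).[t] =
  \sum_(P in NC2 n) t ^+ #|pjoin P (rainbow n)|.
Proof.
move=> n0; have := rainbow_NC2 n.
rewrite inE => /andP[/andP[pR /forall_inP R2] _].
have cardJ (P : {set {set 'I_(2 * n)}}) : P \in NC2 n ->
    (0 < #|pjoin P (rainbow n)| < n.+1)%N.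
  rewrite inE => /andP[/andP[pP _] _].
  have /and4P[pJ _ /forall_inP RJ _] := pjoinP pP pR.
  set J := pjoin P _ in pJ RJ *; have [/eqP cJ tJ J0] := and3P pJ.
  have [/eqP cR _ _] := and3P pR.
  have cT : #|[set: 'I_(2 * n)]| = (2 * n)%N by rewrite cardsT card_ord.
  apply/andP; split.
    rewrite lt0n; apply/eqP => /cards0_eq J00; move: cJ cT.
    by rewrite J00 /cover big_set0 => <-; rewrite cards0; lia.
  (* Each block of the join contains a block of the rainbow, hence at least two of the [2 * n]
     points. *)
  rewrite ltnS -(leq_pmul2l (isT : 0 < 2)%N) -[X in (_ <= X)%N]cT.
  rewrite (card_partition pJ) mulnC -sum_nat_const; apply: leq_sum => B BJ.
  have /set0Pn[x xB] : B != set0 by apply: contraNneq J0 => <-.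
  have /bigcupP[D DR xD] : x \in cover (rainbow n) by rewrite cR inE.
  have /exists_inP[B' B'J /subsetP DB'] := RJ D DR.
  have DB : D \subset B.
    apply/subsetP => y yD.
    by rewrite -(def_pblock tJ BJ xB) (def_pblock tJ B'J (DB' x xD)) DB'.
  by have := subset_leq_card DB; rewrite (eqP (R2 D DR)).
(* The lower half is forced to be the rainbow, so the systems are counted by their upper half. *)
have numE k : semi_meander_number n k =
    (\sum_(P in NC2 n) (#|pjoin P (rainbow n)| == k))%N.
  rewrite -big_mkcondr sum1_card -(card_imset (f := fun P => (P, rainbow n))).
    apply: eq_card => -[P S]; rewrite !inE /=; apply/idP/imsetP => [|[Q]].
      case/andP=> /andP[PN _] /andP[/eqP SE PK]; subst S.
      by exists P => //; rewrite -topredE /= inE PN.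
    rewrite -topredE /= => /andP[QN QK] [-> ->].
    by have := rainbow_NC2 n; rewrite !inE in QN * => -> ; rewrite QN eqxx.
  by move=> P Q [].
rewrite /semi_meander_poly horner_sum.
transitivity (\sum_(1 <= k < n.+1) \sum_(P in NC2 n)
    (if k == #|pjoin P (rainbow n)| then t ^+ k else 0)).
  apply: eq_bigr => k _; rewrite hornerZ hornerXn numE natr_sum mulr_suml.
  by apply: eq_bigr => P _; rewrite eq_sym; case: eqP => _; rewrite ?mul1r ?mul0r.
rewrite exchange_big; apply: eq_bigr => P PN.
(* Only the index equal to the number of components survives, and [cardJ] puts it in the range. *)
by rewrite -big_mkcond big_nat1_eq cardJ.
Qed.

(* The number of ways to read s, starting from the stack u of open arches and
   ending with none: each letter is pushed, or pops an equal letter. *)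
Fixpoint stack_count (T : eqType) (u s : seq T) : nat :=
  if s is a :: s' then
    (stack_count (a :: u) s' +
     (if u is b :: u' then (b == a) * stack_count u' s' else 0))%N
  else u == [::].

(** * Monochromatic non-crossing pairings, counted by reading a word with a stack *)

Section StackCount.
Variables (U : eqType) (n : nat) (w : (2 * n).-tuple U).
Local Notation I := 'I_(2 * n).
Implicit Types (S : seq I) (k : nat) (P : {set {set I}}).

(* The ways to complete a diagram whose arches have been drawn up to position
   k, those starting at the positions in S being still open. *)
Definition completions S k : {set {set {set I}}} :=
  [set P | [&& partition P [set x : I | (x \in S) || (k <= x)%N],
    [forall B in P, #|B| == 2], noncrossing P, monochromatic (tnth w) P &
    [forall x in S, forall y in S, [set x; y] \notin P]]].

Lemma completionsP S k P : reflect
  [/\ partition P [set x : I | (x \in S) || (k <= x)%N],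
      forall B, B \in P -> #|B| = 2,
      forall a b c d : I, (a < b)%N -> (b < c)%N -> (c < d)%N ->
        [set a; c] \in P -> [set b; d] \in P -> False,
      forall x y, [set x; y] \in P -> tnth w x = tnth w y &
      forall x y, x \in S -> y \in S -> [set x; y] \in P -> False]
  (P \in completions S k).
Proof.
rewrite inE; apply: (iffP and5P) => -[pP P2 ncP mP SP]; split=> //.
- by move=> B BP; apply/eqP/(forall_inP P2).
- move=> a b c d ab bc cd acP bdP.
  have /forallP/(_ b)/forallP/(_ c)/forallP/(_ d) := forallP ncP a.
  by rewrite ab bc cd acP bdP.
- by move=> x y xyP; apply: (monochromaticP _ _ mP) xyP _ _;
    rewrite !inE eqxx ?orbT.
- move=> x y xS yS.
  by have /forall_inP/(_ y yS)/negP := forall_inP SP x xS.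
- by apply/forall_inP => B /P2 ->.
- apply/forallP => a; apply/forallP => b; apply/forallP => c; apply/forallP => d.
  apply/implyP => /and3P[ab bc cd]; apply/negP => /andP[].
  exact: ncP ab bc cd.
- apply/monochromaticP => B x y BP; have /eqP/cards2P[a [b [_ BE]]] := P2 B BP.
  rewrite BE !inE; rewrite BE in BP; have ab := mP _ _ BP.
  by move=> /orP[]/eqP-> /orP[]/eqP->.
- apply/forall_inP => x xS; apply/forall_inP => y yS; apply/negP.
  exact: SP.
Qed.

(** The block of [x] has a second element, and two open positions are never joined, so that element
    has yet to be read. *)
Lemma completions_mate S k P x : P \in completions S k -> x \in S ->
  exists2 y : I, (k <= y)%N & [set x; y] \in P.
Proof.
case/completionsP=> pP P2 _ _ SP xS; have [/eqP cP _ _] := and3P pP.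
have /bigcupP[B BP xB] : x \in cover P by rewrite cP inE xS.
have /eqP/cards2P[a [b [_ BE]]] := P2 B BP; subst B.
have mem z : z \in [set a; b] -> (z \in S) || (k <= z)%N.
  by move=> zB; have := subsetP (partitionS pP BP) z zB; rewrite inE.
have aP := mem a (set21 _ _); have bP := mem b (set22 _ _).
move: xB; rewrite !inE => /orP[]/eqP xE; subst x.
  by case/orP: bP => [bS|kb]; [case: (SP a b)|exists b].
by rewrite setUC in BP; case/orP: aP => [aS|ka]; [case: (SP b a)|exists a].
Qed.

Lemma pair_inj P (D : {set I}) (x y z : I) : partition P D ->
  x != y -> [set x; y] \in P -> [set x; z] \in P -> y = z.
Proof.
move=> /partition_trivIset tP xy xyP xzP.
have : y \in [set x; z].
  rewrite -(def_pblock tP xzP (set21 _ _)).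
  by rewrite (def_pblock tP xyP (set21 _ _)) set22.
by rewrite !inE eq_sym (negbTE xy) => /eqP.
Qed.

(** No position is left to close an open arch; with none open, only the empty partition remains. *)
Lemma card_completions_end S : #|completions S (2 * n)| = (S == [::]).
Proof.
case: S => [|x S].
  rewrite (_ : completions _ _ = [set set0]) ?cards1 //.
  apply/setP => P; rewrite in_set1; apply/completionsP/eqP => [[]|->].
    rewrite (_ : [set _ | _] = set0) ?partition_set0; first by move=> /eqP.
    by apply/setP => y; rewrite !inE leqNgt ltn_ord.
  split=> [|B|a b c d _ _ _|x y|//]; rewrite ?inE //.
  rewrite (_ : [set _ | _] = set0) ?partition_set0 //.
  by apply/setP => y; rewrite !inE leqNgt ltn_ord.
apply: eq_card0 => P; apply/negP => PS.
have [y] := completions_mate PS (mem_head x S).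
by rewrite leqNgt ltn_ord.
Qed.

(** The case where [k] opens an arch. The ground set does not change; stacking [k] only forbids
    joining it to an earlier open position. *)
Lemma completions_push S (k : I) :
  (forall x, x \in S -> (x < k)%N) ->
  completions (k :: S) k.+1 =
  [set P in completions S k | [forall x in S, [set x; k] \notin P]].
Proof.
move=> Sk.
have DE : [set x : I | (x \in k :: S) || (k.+1 <= x)%N] =
    [set x : I | (x \in S) || (k <= x)%N].
  apply/setP => x; rewrite !inE (leq_eqVlt k x) (eq_sym (k : nat)) (val_eqE x k).
  by rewrite -!orbA orbCA.
apply/setP => P; rewrite [RHS]inE; apply/completionsP/andP; rewrite DE.
  move=> [pP P2 nP mP SP]; split.
    apply/completionsP; split=> // x y xS yS.
    by apply: SP; rewrite inE ?xS ?yS orbT.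
  by apply/forall_inP => x xS; apply/negP; apply: SP; rewrite inE ?xS ?eqxx ?orbT.
move=> [/completionsP[pP P2 nP mP SP] /forall_inP Pk]; split=> // x y.
rewrite !inE => /orP[/eqP->|xS] /orP[/eqP->|yS].
- by move=> /P2; rewrite setUid cards1.
- by rewrite setUC; apply/negP/Pk.
- by apply/negP/Pk.
- exact: SP.
Qed.

(** If [k] closed some [x] below [h], then [h] would be joined to some [y] beyond [k], and
    [x < h < k < y] would be a crossing. *)
Lemma completions_closing S (k x h : I) P :
  (forall y : I, y \in h :: S -> (y < h)%N || (y == h)) -> (h < k)%N ->
  P \in completions (h :: S) k -> x \in h :: S ->
  [set x; k] \in P -> x = h.
Proof.
move=> Sh hk PS xS xkP; have [//|xh] := eqVneq x h.
have xlt : (x < h)%N by have := Sh x xS; rewrite (negbTE xh) orbF.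
have [y ky hyP] := completions_mate PS (mem_head h S).
have [pP P2 nP _ _] := completionsP _ _ _ PS.
have [yk|yk] := eqVneq y k.
  rewrite yk setUC in hyP; rewrite setUC in xkP.
  by apply/esym/(pair_inj pP _ hyP xkP); apply: contraTneq hk => ->; rewrite ltnn.
have {}yk : (k < y)%N.
  by rewrite ltn_neqAle ky andbT; apply: contra_neq yk => /esym/val_inj.
by case: (nP x h k y).
Qed.

Lemma ordered_pair_inj (a c h k : I) : (a < c)%N -> (h < k)%N ->
  [set a; c] = [set h; k] -> a = h /\ c = k.
Proof.
move=> ac hk E.
have : a \in [set h; k] by rewrite -E set21.
have : c \in [set h; k] by rewrite -E set22.
by rewrite !inE => /orP[]/eqP ? /orP[]/eqP ?; subst => //; move: ac hk; lia.
Qed.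

(** Removing the block of [h] and [k] is a bijection onto the completions of the popped stack,
    provided that the two letters agree. *)
Lemma card_completions_pop (h k : I) S :
  (forall x, x \in S -> (x < h)%N) -> (h < k)%N ->
  #|[set P in completions (h :: S) k | [set h; k] \in P]| =
  ((tnth w h == tnth w k) * #|completions S k.+1|)%N.
Proof.
move=> Sh hk; set B := [set h; k].
set A := [set x : I | (x \in h :: S) || (k <= x)%N].
set A' := [set x : I | (x \in S) || (k.+1 <= x)%N].
(* No remaining point lies between [h] and [k], so putting their block back creates no crossing. *)
have A'h x : x \in A' -> (x < h)%N || (k < x)%N.
  by rewrite inE => /orP[/Sh->|->]; rewrite ?orbT.
have hA' : h \notin A' by apply/negP => /A'h; lia.
have kA' : k \notin A' by apply/negP => /A'h; lia.
have AE : A = B :|: A'.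
  apply/setP => x; rewrite !inE (leq_eqVlt k x) (eq_sym (k : nat)) (val_eqE x k).
  by rewrite -!orbA; congr (_ || _); rewrite orbCA.
have dB : [disjoint B & A'].
  apply/pred0P => x; apply/negP => /andP[/=].
  by rewrite in_set2 => /orP[]/eqP->; apply/negP.
have [hkw|hkw] := eqVneq (tnth w h) (tnth w k); last first.
  rewrite mul0n; apply: eq_card0 => P; rewrite inE; apply/negP.
  by case/andP=> /completionsP[_ _ _ mP _] /mP hkw'; rewrite hkw' eqxx in hkw.
have nB P : partition P A' -> B \notin P.
  move=> pP; apply: contra hA' => BP.
  by apply: (subsetP (partitionS pP BP)); rewrite set21.
rewrite mul1n -[RHS](card_in_imset (f := fun P => B |: P)); last first.
  move=> P Q /completionsP[pP _ _ _ _] /completionsP[pQ _ _ _ _] PQ.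
  by rewrite -(setU1K (nB P pP)) PQ setU1K ?nB.
apply: eq_card => P; rewrite inE; apply/andP/imsetP => [[]|[Q]].
  case/completionsP=> pP P2 nP mP SP BP; exists (P :\ B); last by rewrite setD1K.
  apply/completionsP; split.
  - have := partitionD1 pP BP; rewrite -/A AE setDUl setDv set0U.
    by have -> : A' :\: B = A' by apply/setDidPl; rewrite disjoint_sym.
  - by move=> D /setD1P[_]; exact: P2.
  - by move=> a b c d ab bc cd /setD1P[_ acP] /setD1P[_]; exact: nP acP.
  - by move=> x y /setD1P[_]; exact: mP.
  - by move=> x y xS yS /setD1P[_]; apply: SP; rewrite inE ?xS ?yS orbT.
case/completionsP=> pQ Q2 nQ mQ SQ ->; rewrite setU11; split=> //.
have QA' x y : [set x; y] \in Q -> x \in A' /\ y \in A'.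
  by move=> /(partitionS pQ)/subsetP s; split; apply: s; rewrite ?set21 ?set22.
apply/completionsP; split.
- rewrite -/A AE; apply: partitionU1 => //.
  by apply/set0Pn; exists h; rewrite set21.
- move=> D /setU1P[->|/Q2//]; rewrite cards2 -val_eqE /=; by move: hk; lia.
(* If just one of the two blocks is [B], the other has an endpoint strictly between [h] and [k],
   against [A'h]. *)
- move=> a b c d ab bc cd /setU1P[acB|acQ] /setU1P[bdB|bdQ].
  + have [ah _] := ordered_pair_inj (ltn_trans ab bc) hk acB.
    have [bh _] := ordered_pair_inj (ltn_trans bc cd) hk bdB.
    by move: ab; rewrite ah bh ltnn.
  + have [ah ck] := ordered_pair_inj (ltn_trans ab bc) hk acB.
    have [/A'h + _] := QA' _ _ bdQ.
    by move: ab bc; rewrite ah ck; lia.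
  + have [bh dk] := ordered_pair_inj (ltn_trans bc cd) hk bdB.
    have [_ /A'h] := QA' _ _ acQ.
    by move: bc cd; rewrite bh dk; lia.
  + exact: nQ acQ bdQ.
- move=> x y /setU1P[xyB|/mQ//].
  have : x \in B by rewrite -xyB set21.
  have : y \in B by rewrite -xyB set22.
  by rewrite !inE => /orP[]/eqP-> /orP[]/eqP->.
- move=> x y; rewrite !inE => xS yS /orP[/eqP xyB|xyQ].
    have lt z : (z == h) || (z \in S) -> (z < k)%N.
      by case/orP=> [/eqP->//|/Sh zh]; apply: ltn_trans zh hk.
    have : k \in [set x; y] by rewrite xyB set22.
    rewrite !inE => /orP[]/eqP kE; subst.
      by have := lt _ xS; rewrite ltnn.
    by have := lt _ yS; rewrite ltnn.
  have [xA yA] := QA' _ _ xyQ.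
  case/orP: xS => [/eqP xh|xS]; first by rewrite xh (negbTE hA') in xA.
  case/orP: yS => [/eqP yh|yS]; first by rewrite yh (negbTE hA') in yA.
  exact: SQ xyQ.
Qed.

(* Either k opens an arch, or k closes an open arch; the
   latter must be the last one opened, as any other choice makes a crossing. *)
Lemma card_completions S k :
  sorted gtn (map val S) -> (forall x, x \in S -> (x < k)%N) -> (k <= 2 * n)%N ->
  #|completions S k| = stack_count (map (tnth w) S) (drop k w).
Proof.
(* Induction on the number of positions still to be read. *)
have [m] := ubnP (2 * n - k); elim: m S k => // m IH S k km Ssort Sk.
rewrite leq_eqVlt => /orP[/eqP->|kn].
  rewrite card_completions_end drop_oversize ?size_tuple //.
  by case: S {Ssort Sk}.
pose i := Ordinal kn.
rewrite (drop_nth (tnth w i)) ?size_tuple // -[nth _ _ _](tnth_nth _ w i) /=.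
(* Split according to whether [i] is joined to no open position (push) or to some open position
   (pop). *)
rewrite -(cardsID [set P : {set {set I}} |
    [forall x in S, [set x; i] \notin P]]).
congr (_ + _)%N.
  transitivity #|completions (i :: S) k.+1|.
    by rewrite (completions_push (k := i)) //; apply: eq_card => P; rewrite !inE.
  rewrite IH //=; first by move: km; lia.
    by case: S Ssort Sk => //= h S -> Sk; rewrite Sk ?mem_head.
  by move=> x; rewrite inE => /orP[/eqP->//|/Sk xk]; exact: ltnW.
case: S Ssort Sk => [|h S] Ssort Sk /=.
  apply: eq_card0 => P; rewrite !inE; apply/negP => /andP[/negP[]].
  by apply/forall_inP.
have Sh x : x \in S -> (x < h)%N.
  move: Ssort => /=; rewrite path_sortedE; last by move=> a b c; lia.
  by case/andP=> /allP hS _ xS; apply: hS; exact: map_f.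
have hk : (h < i)%N by apply: Sk; exact: mem_head.
(* By [completions_closing], the open position joined to [i] can only be the top [h] of the
   stack. *)
transitivity #|[set P in completions (h :: S) i | [set h; i] \in P]|.
  apply: eq_card => P; apply/setDP/setIdP => -[PS hP]; split=> //.
    apply: contraNT hP => hP; rewrite inE; apply/forall_inP => x xS.
    apply/negP => xP; move/negP: hP; apply.
    rewrite -(completions_closing _ hk PS xS xP) //.
    by move=> y; rewrite inE => /orP[->|/Sh->]; rewrite ?orbT.
  apply/negP; rewrite inE => /forall_inP/(_ h (mem_head _ _)).
  by rewrite hP.
rewrite card_completions_pop // IH //=; first by have := kn; move: km; lia.
  by move: Ssort; apply: path_sorted.
by move=> x /Sh xh; rewrite ltnS ltnW // (ltn_trans xh).
Qed.

Lemma card_NC2_monochromatic :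
  #|[set P in NC2 n | monochromatic (tnth w) P]| = stack_count [::] w.
Proof.
rewrite -[tval w in RHS]drop0 -(@card_completions [::] 0) //.
apply: eq_card => P; rewrite !inE /pair_partition.
have -> : [set x : I | (x \in [::]) || (0 <= x)%N] = [set: I].
  by apply/setP => x; rewrite !inE.
have -> : [forall x in ([::] : seq I), forall y in ([::] : seq I),
    [set x; y] \notin P].
  by apply/forall_inP.
by rewrite andbT -!andbA.
Qed.

End StackCount.

(** * Palindromes as the colourings compatible with the rainbow *)

Section Mirror.
Variables (d n : nat).
Local Notation I := 'I_(2 * n).

Lemma monochromatic_rainbow (c : I -> 'I_d) :
  monochromatic c (rainbow n) = [forall x, c x == c (rev_ord x)].
Proof.
apply/monochromaticP/forallP => [h x|h B x y].
  apply/eqP/(h [set x; rev_ord x]); rewrite ?set21 ?set22 // rainbow_pair /=.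
  by have := ltn_ord x; lia.
case/imsetP=> i _ -> /set2P[]-> /set2P[]-> //; first exact/eqP.
by apply/esym/eqP.
Qed.

Lemma size_mirror (v : n.-tuple 'I_d) : size (v ++ rev v) == (2 * n)%N.
Proof. by rewrite size_cat size_rev !size_tuple addnn mul2n. Qed.

Definition mirror v : (2 * n).-tuple 'I_d := Tuple (size_mirror v).

Lemma mirror_rev v x : tnth (mirror v) (rev_ord x) = tnth (mirror v) x.
Proof.
have x2n := ltn_ord x; set a := tnth _ x.
rewrite /a !(tnth_nth a) /= !nth_cat size_tuple.
case: ltnP => rx; case: ltnP => xn; try by (exfalso; lia).
  by rewrite nth_rev size_tuple; [congr nth; lia | lia].
by rewrite nth_rev size_tuple; [congr nth; lia | lia].
Qed.

(** Constancy on the rainbow is symmetry under [rev_ord], so such a colouring is determined by its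
    first half, and any first half extends by reflection. *)
Lemma card_mirror_monochromatic P :
  #|[set v : n.-tuple 'I_d | monochromatic (tnth (mirror v)) P]| =
  #|[set c : {ffun I -> 'I_d} |
     monochromatic c P && monochromatic c (rainbow n)]|.
Proof.
have wn : (n <= 2 * n)%N by lia.
pose f v : {ffun I -> 'I_d} := [ffun x => tnth (mirror v) x].
have fE v : f v =1 tnth (mirror v) by move=> x; rewrite ffunE.
pose g (c : {ffun I -> 'I_d}) := [tuple c (widen_ord wn k) | k < n].
have fK : cancel f g.
  move=> v; apply: eq_from_tnth => k; rewrite tnth_mktuple fE.
  rewrite (tnth_nth (tnth v k)) [RHS](tnth_nth (tnth v k)) nth_cat size_tuple.
  by rewrite /= ltn_ord.
rewrite -(card_imset _ (can_inj fK)); apply: eq_card => c.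
rewrite inE monochromatic_rainbow; apply/imsetP/andP => [[v]|[cP /forallP cR]].
  rewrite inE => vP ->; rewrite (eq_monochromatic _ (fE v)) vP; split=> //.
  by apply/forallP => x; rewrite !fE mirror_rev.
have cE : c = f (g c).
  have low (x : I) : (x < n)%N -> c x = f (g c) x.
    move=> xn; rewrite fE (tnth_nth (c x)) nth_cat size_tuple xn.
    rewrite -(tnth_nth (c x) (g c) (Ordinal xn)) tnth_mktuple.
    by congr (c _); exact: val_inj.
  apply/ffunP => x; have [/low//|nx] := ltnP x n.
  rewrite (eqP (cR x)) low; first by rewrite !fE mirror_rev.
  by have := ltn_ord x; move: nx => /=; lia.
by exists (g c); rewrite // inE -(eq_monochromatic _ (fE _)) -cE.
Qed.

(** Double counting of the pairs of a word and a pairing that its mirror colours; for a fixed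
    pairing, the colourings are those constant on the join with the rainbow. *)
Lemma sum_stack_count :
  (\sum_(v : n.-tuple 'I_d) stack_count [::] (v ++ rev v) =
   \sum_(P in NC2 n) d ^ #|pjoin P (rainbow n)|)%N.
Proof.
transitivity (\sum_(v : n.-tuple 'I_d) \sum_(P in NC2 n)
    monochromatic (tnth (mirror v)) P)%N.
  apply: eq_bigr => v _; rewrite -[v ++ rev v]/(tval (mirror v)).
  by rewrite -card_NC2_monochromatic -sum1dep_card big_mkcondr.
rewrite exchange_big; apply: eq_bigr => P; rewrite inE => /andP[/andP[pP _] _].
have := rainbow_NC2 n; rewrite inE => /andP[/andP[pR _] _].
have /and4P[pJ _ _ _] := pjoinP pP pR.
rewrite -(card_monochromatic _ pJ) -big_mkcond sum1dep_card.
rewrite card_mirror_monochromatic; apply: eq_card => c.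
by rewrite !inE monochromatic_pjoin.
Qed.

End Mirror.

From mathcomp Require Import all_classical all_reals all_analysis.

(** * The operators in coordinates indexed by words *)

Section Coordinates.
Variables (R : realType) (d : nat).
Local Notation C := R[i].
Local Notation H := (fock R d).
Implicit Types (x y : H) (s u : seq 'I_d) (i j : 'I_d).

(** Plain sequences as indices let words grow and shrink without casts between tuple types. *)
Definition coord x s : C := x (size s) (in_tuple s).

Lemma coord_tuple x n (w : n.-tuple 'I_d) : coord x w = x n w.
Proof.
case: w => s sz; move: (eqP sz) => n_s; subst n.
by rewrite /coord /=; congr (x _ _); apply: val_inj.
Qed.

Lemma coordP x y : coord x =1 coord y -> x = y.
Proof.
by move=> xy; apply: fockP => n; apply/ffunP => w; rewrite -!coord_tuple xy.
Qed.

Lemma coordD x y s : coord (x + y) s = coord x s + coord y s.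
Proof. by rewrite /coord fock_addE ffunE. Qed.

Lemma coord_vacuum s : coord (vacuum R d) s = (s == [::])%:R.
Proof.
rewrite /coord; case: s => [|a s] /=; first by rewrite embed_comp_id ffunE.
by rewrite embed_comp_neq // ffunE.
Qed.

Lemma vacuum_stateE (X : bop R d) : vacuum_state X = coord (X (vacuum R d)) [::].
Proof.
rewrite /vacuum_state fdot_embed /tdot /coord (bigD1 [tuple]) //= ffunE.
rewrite conjC1 mulr1 big1 ?addr0 => [|w]; last by rewrite tuple0.
by congr (fock_comp _ _ _); apply: val_inj.
Qed.

(** Coordinates are inner products with basis vectors, so the adjoint is known once [A] is known on
    the basis; creation operators permit this by mapping words to words. *)
Lemma coord_adj (A : bop R d) y s :
  coord (adj A y) s = fdot y (A (Defs.basis R (in_tuple s))).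
Proof. by rewrite [RHS]fdotC adjP -fdotC fdot_basis. Qed.

Lemma coord_lcreation0 i x : coord (lcreation R i x) [::] = 0.
Proof. by rewrite /coord /= ffunE. Qed.

Lemma coord_lcreation i x j s :
  coord (lcreation R i x) (j :: s) = (j == i)%:R * coord x s.
Proof.
rewrite /coord /= ffunE /thead (tnth_nth j) mxE eqxx /=; congr (_ * x _ _).
exact: val_inj.
Qed.

Lemma coord_rcreation0 i x : coord (rcreation R i x) [::] = 0.
Proof. by rewrite /coord /= ffunE. Qed.

Lemma tnth_rcons_last n (w : n.-tuple 'I_d) j :
  tnth (rcons_tuple w j) ord_max = j.
Proof. by rewrite (tnth_nth j) /= nth_rcons size_tuple ltnn eqxx. Qed.

Lemma tnth_rcons_belast n (w : n.-tuple 'I_d) j :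
  [tuple tnth (rcons_tuple w j) (widen_ord (leqnSn n) k) | k < n] = w.
Proof.
apply: eq_from_tnth => k; rewrite tnth_mktuple !(tnth_nth j) /= nth_rcons.
by rewrite size_tuple ltn_ord.
Qed.

Lemma coord_rcreation i x j s :
  coord (rcreation R i x) (rcons s j) = (j == i)%:R * coord x s.
Proof.
rewrite (coord_tuple _ (rcons_tuple (in_tuple s) j)) /= ffunE mxE eqxx /=.
by rewrite tnth_rcons_last tnth_rcons_belast mulrC.
Qed.

Lemma lcreation_basis i n (w : n.-tuple 'I_d) :
  lcreation R i (Defs.basis R w) = Defs.basis R (cons_tuple i w).
Proof.
rewrite shift_embed; congr embed; apply/ffunP; case/tupleP => j v.
rewrite !ffunE theadE mxE eqxx /=.
rewrite (_ : behead_tuple [tuple of j :: v] = v); last exact: val_inj.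
by rewrite -natrM mulnb -!val_eqE /= eqseq_cons.
Qed.

Lemma rcreation_basis i n (w : n.-tuple 'I_d) :
  rcreation R i (Defs.basis R w) = Defs.basis R (rcons_tuple w i).
Proof.
rewrite shift_embed; congr embed; apply/ffunP => v.
(* Right creation acts at the end of a word, so the index is split at its last letter. *)
have [j [v' ->]] : exists j, exists v' : n.-tuple 'I_d, v = rcons_tuple v' j.
  case: v => s; case/lastP: s => [|s j]; first by [].
  move=> /[dup]; rewrite {1}size_rcons eqSS => sz sz'.
  by exists j, (Tuple sz); apply: val_inj.
rewrite !ffunE tnth_rcons_last tnth_rcons_belast mxE eqxx /=.
by rewrite -natrM mulnb -!val_eqE /= eqseq_rcons.
Qed.

Lemma coord_adj_lcreation i x s :
  coord (adj (lcreation R i) x) s = coord x (i :: s).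
Proof. by rewrite coord_adj lcreation_basis fdot_basis -coord_tuple. Qed.

Lemma coord_adj_rcreation i x s :
  coord (adj (rcreation R i) x) s = coord x (rcons s i).
Proof. by rewrite coord_adj rcreation_basis fdot_basis -coord_tuple. Qed.

Definition lsemicircular i : bop R d := lcreation R i + adj (lcreation R i).
Definition rsemicircular i : bop R d := rcreation R i + adj (rcreation R i).
Local Notation X := lsemicircular.
Local Notation Y := rsemicircular.

(** The two terms are the two moves of [stack_count] on the stack [s]: annihilation pushes [i],
    creation pops a letter equal to [i]. *)
Lemma coord_lsemicircular i x s : coord (X i x) s =
  coord x (i :: s) + (if s is j :: s' then (j == i)%:R * coord x s' else 0).
Proof.
rewrite coordD coord_adj_lcreation addrC; congr (_ + _).
by case: s => [|j s]; rewrite ?coord_lcreation0 ?coord_lcreation.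
Qed.

Lemma coord_rsemicircular0 i x : coord (Y i x) [::] = coord x [:: i].
Proof. by rewrite coordD coord_adj_rcreation coord_rcreation0 add0r. Qed.

Lemma coord_rsemicircular i x s j : coord (Y i x) (rcons s j) =
  coord x (rcons (rcons s j) i) + (j == i)%:R * coord x s.
Proof. by rewrite coordD coord_adj_rcreation coord_rcreation addrC. Qed.

(* The commutators [L_i, R_j^*] and [L_i^*, R_j] are opposite multiples of the
   projection on the vacuum, so they cancel. *)
Lemma semicircular_comm i j x : X i (Y j x) = Y j (X i x).
Proof.
apply: coordP => s; rewrite coord_lsemicircular.
case/lastP: s => [|s b].
  rewrite coord_rsemicircular0 coord_lsemicircular.
  by rewrite (coord_rsemicircular _ _ [::]) eq_sym addr0.
rewrite coord_rsemicircular coord_lsemicircular -rcons_cons coord_rsemicircular.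
(* A one-letter word is treated apart, its first and last letters being the same. *)
case: s => [|a s]; rewrite /= ?coord_lsemicircular -?rcons_cons.
  rewrite (coord_rsemicircular0 j x) addr0 -!addrA; congr (_ + _).
  by rewrite addrC.
rewrite coord_rsemicircular !mulrDr -!addrA; congr (_ + _).
by rewrite addrCA; congr (_ + (_ + _)); rewrite mulrCA.
Qed.

(** Annihilation kills the vacuum, and left and right creation both produce the word with the single
    letter [i]. *)
Lemma rsemicircular_vacuum i : Y i (vacuum R d) = X i (vacuum R d).
Proof.
apply: coordP => s; rewrite coord_lsemicircular.
case/lastP: s => [|s b]; first by rewrite coord_rsemicircular0 addr0.
rewrite coord_rsemicircular !coord_vacuum -!size_eq0 !size_rcons add0r /=.
case: s => [|a s] /=; rewrite !coord_vacuum -?size_eq0 /=;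
  by rewrite ?size_rcons ?mulr0 ?add0r.
Qed.

Definition lword s : bop R d := \prod_(i <- s) X i.

Lemma lword_cons i s x : lword (i :: s) x = X i (lword s x).
Proof. by rewrite /lword big_cons. Qed.

Lemma lword_cat s u x : lword (s ++ u) x = lword s (lword u x).
Proof. by rewrite /lword big_cat. Qed.

Lemma lword1 i : lword [:: i] = X i.
Proof. by rewrite /lword big_seq1. Qed.

(** Lets [Y j] travel through a word down to the vacuum, where it becomes [X j]. *)
Lemma rsemicircular_lword j s x : Y j (lword s x) = lword s (Y j x).
Proof.
elim: s => [|i s IH]; first by rewrite /lword big_nil.
by rewrite !lword_cons -semicircular_comm IH.
Qed.

(** Both sides obey the same recursion on [s], the index [u] playing the stack; the vacuum imposes
    that the final stack be empty. *)
Lemma coord_lword_vacuum s u :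
  coord (lword s (vacuum R d)) u = (stack_count u s)%:R.
Proof.
elim: s u => [|a s IH] u; first by rewrite /lword big_nil /= coord_vacuum.
rewrite lword_cons coord_lsemicircular IH /= natrD; congr (_ + _).
by case: u => [|b u]; rewrite // IH natrM.
Qed.

Lemma bop_sumE I (r : seq I) (F : I -> bop R d) x :
  (\sum_(i <- r) F i) x = \sum_(i <- r) F i x.
Proof. by elim/big_rec2: _ => // i y1 y2 _ <-. Qed.

Lemma bop_linear_sum (A : bop R d) I (r : seq I) (F : I -> H) :
  A (\sum_(i <- r) F i) = \sum_(i <- r) A (F i).
Proof. exact: linear_sum. Qed.

Lemma fock_T_apply x : fock_T R d x = \sum_(i < d) X i (Y i x).
Proof. exact: bop_sumE. Qed.

(** One more factor [X j * Y j] adds the letter [j] at both ends of a palindrome: on the left by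
    [X j], on the right by [Y j] after it reaches the vacuum. *)
Lemma fock_T_exp_vacuum n : (fock_T R d ^+ n) (vacuum R d) =
  \sum_(w : n.-tuple 'I_d) lword (w ++ rev w) (vacuum R d).
Proof.
elim: n => [|n IH].
  rewrite (bigD1 [tuple]) //= big1 ?addr0 => [|w]; last by rewrite tuple0.
  by rewrite /lword big_nil.
rewrite exprS -[LHS]/(fock_T R d ((fock_T R d ^+ n) (vacuum R d))) IH.
rewrite fock_T_apply.
rewrite (eq_bigr (fun j => \sum_(w : n.-tuple 'I_d)
    lword (cons_tuple j w ++ rev (cons_tuple j w)) (vacuum R d))); last first.
  move=> j _; rewrite !bop_linear_sum; apply: eq_bigr => w _.
  rewrite rsemicircular_lword rsemicircular_vacuum [RHS]/= lword_cons.
  congr (X j _).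
  by rewrite rev_cons -cats1 catA [in RHS]lword_cat lword1.
rewrite pair_bigA.
(* A word of length [n.+1] is a first letter and a word of length [n]. *)
rewrite [RHS](reindex (fun p : 'I_d * n.-tuple 'I_d => cons_tuple p.1 p.2)) //=.
exists (fun w => (thead w, behead_tuple w)) => [[j w]|w] _ /=.
  by rewrite theadE; congr pair; apply: val_inj.
by apply: val_inj; case/tupleP: w.
Qed.

Lemma vacuum_state_fock_T_exp n : vacuum_state (fock_T R d ^+ n) =
  (\sum_(w : n.-tuple 'I_d) stack_count [::] (w ++ rev w))%:R.
Proof.
rewrite vacuum_stateE fock_T_exp_vacuum natr_sum /coord fock_sumE sum_ffunE.
by apply: eq_bigr => w _; rewrite -coord_lword_vacuum.
Qed.

Lemma fdotD_adj (A : bop R d) x y :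
  fdot ((A + adj A) x) y = fdot x ((A + adj A) y).
Proof.
rewrite fdotDl fdotDr adjP [in LHS]addrC; congr (_ + _).
by rewrite fdotC -adjP -fdotC.
Qed.

Lemma fock_T_selfadjoint : adj (fock_T R d) = fock_T R d.
Proof.
apply/esym/adj_unique => x y; rewrite !fock_T_apply.
rewrite (big_morph (fun z => fdot z y) (fun a b => fdotDl a b y) (fdot0l y)).
rewrite (big_morph (fdot x) (fun a b => fdotDr a b x) (fdot0r x)).
by apply: eq_bigr => i _; rewrite !fdotD_adj -semicircular_comm.
Qed.

End Coordinates.

Theorem proposition1p1 (R : realType) (d : nat) (d_gt0 : (0 < d)%N) :
  adj (fock_T R d) = fock_T R d /\
  forall n : nat, (0 < n)%N ->
    vacuum_state (fock_T R d ^+ n) = (semi_meander_poly n).[d%:Z]%:~R.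
Proof.
split=> [|n n_gt0]; first exact: fock_T_selfadjoint.
rewrite vacuum_state_fock_T_exp sum_stack_count semi_meander_polyE //.
(* A natural number and an integer, both cast to the complex numbers, are compared term by term. *)
rewrite natr_sum rmorph_sum; apply: eq_bigr => P _.
by rewrite natrX rmorphXn.
Qed.
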